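(* Let $M=e^H$ be a convex exponential set in $\Sigma$. The map $\Pi_M:E(NM)\to M$ that assigns to $r\in E(NM)$ the (unique) point $p\in M$ such that the geodesic joining $r$ and $p$ is orthogonal to $M$ at $p$ is contractive for the geodesic metric: $dist(\Pi_M(r),\Pi_M(s))\le dist(r,s)$ for all $r,s\in E(NM)$.
   Context: ${\cal A}$ is a von Neumann algebra with a finite, normal, faithful tracial state $\tau$; ${\cal A}_h$ is the real space of selfadjoint elements; $\Sigma=e^{{\cal A}_h}$ is the set of positive invertible elements of ${\cal A}$, an open subset of ${\cal A}_h$ in the operator norm, with tangent space ${\cal A}_h$ at each point. For $a\in\Sigma$, $x,y\in{\cal A}_h$ put $\langle x,y\rangle_a=\tau(xa^{-1}ya^{-1})$, $\|x\|_a=\langle x,x\rangle_a^{1/2}$. A smooth curve is a continuously differentiable (for the operator norm) curve $\gamma:[0,1]\to\Sigma$, $Length(\gamma)=\int_0^1\|\dot\gamma(t)\|_{\gamma(t)}\,dt$, and $dist(a,b)$ is the infimum of lengths of smooth curves in $\Sigma$ joining $a$ and $b$. For $p,q\in\Sigma$ the geodesic joining $p$ to $q$ is $\delta_{p,q}(t)=p^{1/2}(p^{-1/2}qp^{-1/2})^tp^{1/2}$, and ${\rm Exp}_p(v)=p^{1/2}e^{p^{-1/2}vp^{-1/2}}p^{1/2}$ for $v\in{\cal A}_h$. A subset $M\subset\Sigma$ is convex if $\delta_{p,q}(t)\in M$ for all $p,q\in M$ and all real $t$. An exponential set is $M=e^H$ with $H$ a norm closed real subspace of ${\cal A}_h$.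 For a convex exponential set $M=e^H$ and $p\in M$, $T_pM=p^{1/2}Hp^{1/2}$ and $(T_pM)^\perp=\{v\in{\cal A}_h:\langle v,w\rangle_p=0\ \forall w\in T_pM\}$. The normal bundle is $NM=\{(p,v):p\in M, v\in(T_pM)^\perp\}$ and $E:NM\to\Sigma$ is $E(p,v)={\rm Exp}_p(v)$. The geodesic joining $r={\rm Exp}_p(v)$ and $p$ is orthogonal to $M$ at $p$ when $v\in(T_pM)^\perp$; for each $r\in\Sigma$ there is at most one $p\in M$ with this property, so $\Pi_M$ is well defined on $E(NM)$ by $\Pi_M({\rm Exp}_p(v))=p$. *)

(* Defs.v *)
From HB Require Import structures.
From mathcomp Require Import all_boot all_order all_algebra.
From mathcomp Require Import complex sesquilinear.
From mathcomp Require Import all_classical all_reals all_analysis.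

Set Implicit Arguments.
Unset Strict Implicit.
Unset Printing Implicit Defensive.

Import Order.TTheory GRing.Theory Num.Theory.
Import numFieldNormedType.Exports.

Local Open Scope classical_set_scope.
Local Open Scope ring_scope.
Local Open Scope complex_scope.

(* [dot] is linear in its first argument and conjugate-linear in its second;
   norms of complex normed spaces take their values in [R[i]]. *)
HB.mixin Record CompleteNormedModule_isHilbert (R : realType) V
    & CompleteNormedModule R[i] V := {
  dot : {dot V for Num.conj};
  sqr_norm_dot : forall u : V, `|u| ^+ 2 = dot u u
}.

#[short(type="hilbertType")]
HB.structure Definition Hilbert (R : realType) :=
  {V of CompleteNormedModule R[i] V & CompleteNormedModule_isHilbert R V}.

(* A von Neumann algebra of operators on the Hilbert space [V], presented as
   the type [A] of its elements together with the inclusion [rep] of [A] into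
   the bounded operators on [V].  The product, the adjoint and the norm of [A]
   are those of operators ([rep_norm_le] and [rep_norm_min] say that the norm is
   the operator norm, so [rep] is injective, and the algebra laws of [A] follow
   from those of operators), and the image of [rep] is equal to its bicommutant.
   Completeness is no extra assumption, since a bicommutant is norm closed.
   Library rings are not used for [A] because no library structure combines a
   noncommutative ring with a norm. *)
HB.mixin Record CompleteNormedModule_isVonNeumann
    (R : realType) (V : hilbertType R) A & CompleteNormedModule R[i] A := {
  op_one : A;
  op_mul : A -> A -> A;
  star : A -> A;
  rep : A -> {linear V -> V};
  repP : forall (c : R[i]) (x y : A) (u : V),
    rep (c *: x + y) u = c *: rep x u + rep y u;
  rep1 : forall u : V, rep op_one u = u;
  repM : forall (x y : A) (u : V), rep (op_mul x y) u = rep x (rep y u);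
  rep_star : forall (x : A) (u v : V),
    dot (rep x u) v = dot u (rep (star x) v);
  rep_norm_le : forall (x : A) (u : V), `|rep x u| <= `|x| * `|u|;
  rep_norm_min : forall (x : A) (c : R[i]), 0 <= c ->
    (forall u : V, `|rep x u| <= c * `|u|) -> `|x| <= c;
  rep_bicommutant : forall T : {linear V -> V}, continuous T ->
    (forall S : {linear V -> V}, continuous S ->
      (forall (x : A) (u : V), S (rep x u) = rep x (S u)) ->
      forall u : V, T (S u) = S (T u)) ->
    exists x : A, forall u : V, rep x u = T u
}.

#[short(type="vonNeumannType")]
HB.structure Definition VonNeumann (R : realType) (V : hilbertType R) :=
  {A of CompleteNormedModule R[i] A & CompleteNormedModule_isVonNeumann R V A}.

Local Notation "x ** y" := (op_mul x y) (at level 40, left associativity).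

Section VonNeumannAlgebra.
Context {R : realType} {V : hilbertType R} {A : vonNeumannType V}.
Implicit Types (a b p q r v w x y : A) (t : R).

Definition selfadj : set A := [set x | star x = x].

Definition op_le x y := forall u : V, 0 <= dot (rep (y - x) u) u.

Definition op_directed (D : set A) :=
  forall x y, D x -> D y -> exists z, [/\ D z, op_le x z & op_le y z].

Definition op_lub (D : set A) x :=
  [/\ selfadj x, forall d, D d -> op_le d x &
      forall y, selfadj y -> (forall d, D d -> op_le d y) -> op_le x y].

Definition normal_functional (tau : {scalar A}) :=
  forall (D : set A) x, D !=set0 -> D `<=` selfadj -> op_directed D ->
    op_lub D x -> complex.Re (tau x) = sup [set complex.Re (tau d) | d in D].

Record tracial_state (tau : {scalar A}) : Prop := TracialState {
  state_ge0 : forall x, 0 <= tau (star x ** x);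
  state1 : tau op_one = 1;
  state_tracial : forall x y, tau (x ** y) = tau (y ** x);
  state_faithful : forall x, tau (star x ** x) = 0 -> x = 0;
  state_normal : normal_functional tau
}.

Definition invA a : A := xget 0 [set b | b ** a = op_one /\ a ** b = op_one].

Definition expA x : A :=
  limn (series (fun n : nat => (n`!%:R : R[i])^-1 *: iter n (op_mul x) op_one)).

Definition Sigma : set A := expA @` selfadj.

(* The exponential is injective on selfadjoint elements, so for [a] in [Sigma]
   this is its selfadjoint logarithm and [powA a t] is the real power [a^t] of
   the functional calculus. *)
Definition logA a : A := xget 0 [set x | selfadj x /\ expA x = a].

Definition powA a t : A := expA (t%:C *: logA a).

Definition geodesic p q t : A :=
  powA p 2^-1 ** powA (powA p (- 2^-1) ** q ** powA p (- 2^-1)) t ** powA p 2^-1.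

Definition Exp p v : A :=
  powA p 2^-1 ** expA (powA p (- 2^-1) ** v ** powA p (- 2^-1)) ** powA p 2^-1.

Definition g_convex (M : set A) :=
  forall p q t, M p -> M q -> M (geodesic p q t).

Definition closed_real_subspace (H : set A) :=
  [/\ H `<=` selfadj, H 0, (forall x y, H x -> H y -> H (x + y)),
      (forall t x, H x -> H (t%:C *: x)) & closed H].

Definition exponential_set (H : set A) : set A := expA @` H.

(* The increment [h] is a nonzero real such that [t + h] stays in the unit
   interval, so derivatives are one-sided at the endpoints; limits in [A] are in
   the operator norm. *)
Definition diff_quotient (gamma : R -> A) t : set_system A :=
  (h^-1)%:C *: (gamma (t + h) - gamma t)
    @[h --> within [set h : R | t + h \in `[0, 1]] 0^'].

Definition velocity (gamma : R -> A) t : A := lim (diff_quotient gamma t).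

Definition smooth_curve (gamma : R -> A) :=
  [/\ forall t, t \in `[0, 1] -> Sigma (gamma t),
      forall t, t \in `[0, 1] -> cvg (diff_quotient gamma t) &
      {within `[0, 1], continuous (velocity gamma)}].

Section Metric.
Variable tau : {scalar A}.

Definition inner a x y : R[i] := tau (x ** invA a ** y ** invA a).

(* [inner a x x] is a nonnegative real when [a] is in [Sigma] and [x] is
   selfadjoint. *)
Definition norm_at a x : R := Num.sqrt (complex.Re (inner a x x)).

Definition Length (gamma : R -> A) : R :=
  \int[lebesgue_measure]_(t in `[0, 1]) norm_at (gamma t) (velocity gamma t).

Definition dist a b : R :=
  inf [set Length gamma | gamma in
    [set gamma | [/\ smooth_curve gamma, gamma 0 = a & gamma 1 = b]]].

Definition tangent (H : set A) p : set A :=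
  [set powA p 2^-1 ** h ** powA p 2^-1 | h in H].

Definition normal_space (H : set A) p : set A :=
  [set v | selfadj v /\ forall w, tangent H p w -> inner p v w = 0].

Definition normal_bundle (H : set A) : set (A * A) :=
  [set pv | exponential_set H pv.1 /\ normal_space H pv.1 pv.2].

Definition bundle_exp (pv : A * A) : A := Exp pv.1 pv.2.

(* For [e^H] convex there is at most one such [p]; outside the image of the
   normal bundle the value is irrelevant. *)
Definition PiM (H : set A) r : A :=
  xget 0 [set p | exists v, normal_bundle H (p, v) /\ r = bundle_exp (p, v)].

End Metric.

End VonNeumannAlgebra.

(* Main.v *)
Require Import Defs.
From HB Require Import structures.
From mathcomp Require Import all_boot all_order all_algebra.
From mathcomp Require Import complex sesquilinear.
From mathcomp Require Import all_classical all_reals all_analysis.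
From mathcomp Require Import ring lra.

Set Implicit Arguments.
Unset Strict Implicit.
Unset Printing Implicit Defensive.

Import Order.TTheory GRing.Theory Num.Theory.
Import numFieldNormedType.Exports.

Local Open Scope classical_set_scope.
Local Open Scope ring_scope.
Local Open Scope complex_scope.

(** Exponential coordinates reduce the theorem to the geometry of a space of
    nonpositive curvature.  If [x = g (star g)] with [g] invertible, every [y] in
    [Sigma] is [g e^k (star g)] for a unique self-adjoint [k], and [gdist x y] is
    the norm of [k] for the inner product of the trace.  This is the length of the
    geodesic from [x] to [y] ([geodesic_curve]) and a lower bound for the length of
    every curve joining them ([gdist_le_Length]), so it is the distance.

    The curvature enters through the exponential metric increasing property
    [gdist_coord_ge]: passing to exponential coordinates at a point does not
    increase distances.  Its infinitesimal form says that the differential of the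
    exponential at [c], transported to the identity by [e^{-c/2}] on both sides,
    does not decrease norms.  That differential is the average over [w] in
    [-1/2, 1/2] of the conjugations [d |-> e^{wc} d e^{-wc}], and the inner product
    of each of them with [d] is at least the squared norm of [d], by the
    Cauchy-Schwarz inequality ([conj_trace_ge]).

    Let [p] and [q] be the projections of [r = Exp_p v] and [s = Exp_q w], and
    write [d] for the distance.  By convexity of [e^H] the logarithm of [q] at [p]
    lies in [H], so it is orthogonal to [v], and the metric increasing property
    gives [d(q,r)^2 >= d(p,q)^2 + d(p,r)^2] ([normal_pythagoras]); symmetrically
    [d(p,s)^2 >= d(p,q)^2 + d(q,s)^2].  The same property, used along the geodesic
    from [r] to [s], gives Reshetnyak's inequality
    [d(p,s)^2 + d(q,r)^2 <= d(p,r)^2 + d(q,s)^2 + 2 d(p,q) d(r,s)]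
    ([quadrilateral_le]).  Together they give [d(p,q)^2 <= d(p,q) d(r,s)].

    The functional calculus involved is that of two power series.  An operator
    whose quadratic form is bounded below by a positive constant is a positive
    multiple of some [1 - z] with [z] of norm less than one, so the Mercator series
    provides its logarithm ([coercive_log]). *)

Local Notation "t *r x" := (t%:C *: x) (at level 40).

(** * Real norms and mean value inequalities *)

Section RealNorm.
Context {R : realType} {W : normedModType R[i]}.
Implicit Types x y : W.

Lemma rscaleN (t : R) x : (- t) *r x = - (t *r x).
Proof. by rewrite -scaleNr; congr (_ *: _); exact: rmorphN. Qed.

Lemma rscaleD (s t : R) x : (s + t) *r x = s *r x + t *r x.
Proof. by rewrite -scalerDl; congr (_ *: _); exact: rmorphD. Qed.

Lemma rscaleB (s t : R) x : (s - t) *r x = s *r x - t *r x.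
Proof. by rewrite rscaleD rscaleN. Qed.

Lemma rscaleA (s t : R) x : s *r (t *r x) = (s * t) *r x.
Proof. by rewrite scalerA; congr (_ *: _); exact/esym/rmorphM. Qed.

Definition rnorm x : R := complex.Re `|x|.

Lemma rnormE x : `|x| = (rnorm x)%:C.
Proof.
have := normr_ge0 x; rewrite /rnorm lecE; case: `|x| => a b /= /andP[/eqP -> _] //.
Qed.

Lemma rnorm_ge0 x : 0 <= rnorm x.
Proof. by rewrite -ler0c -rnormE. Qed.

Lemma rnorm0 : rnorm 0 = 0.
Proof. by rewrite /rnorm normr0. Qed.

Lemma rnorm_eq0 x : rnorm x = 0 -> x = 0.
Proof. by move=> e; apply: normr0_eq0; rewrite rnormE e. Qed.

Lemma rnormN x : rnorm (- x) = rnorm x.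
Proof. by rewrite /rnorm normrN. Qed.

Lemma rnormBC x y : rnorm (x - y) = rnorm (y - x).
Proof. by rewrite -rnormN opprB. Qed.

Lemma rnormD x y : rnorm (x + y) <= rnorm x + rnorm y.
Proof. by rewrite -lecR rmorphD /= -!rnormE ler_normD. Qed.

Lemma rnormB x y : rnorm (x - y) <= rnorm x + rnorm y.
Proof. by rewrite -(rnormN y) rnormD. Qed.

Lemma rnormZ (t : R) x : rnorm (t *r x) = `|t| * rnorm x.
Proof.
apply: complexI; rewrite -rnormE normrZ rnormE rmorphM /=; congr (_ * _).
by rewrite normc_def /= expr0n addr0 sqrtr_sqr.
Qed.

Lemma rnorm_sum I (s : seq I) (P : pred I) (f : I -> W) :
  rnorm (\sum_(i <- s | P i) f i) <= \sum_(i <- s | P i) rnorm (f i).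
Proof.
elim/big_rec2: _ => [|i y1 y2 _ h]; first by rewrite rnorm0.
by apply: (le_trans (rnormD _ _)); rewrite lerD2l.
Qed.

Lemma rnorm_dist x y : `|rnorm x - rnorm y| <= rnorm (x - y).
Proof.
rewrite ler_norml; apply/andP; split.
  by rewrite lerBrDl -lerBDr opprK addrC rnormBC (le_trans _ (rnormD _ _))// subrK.
by rewrite lerBlDr (le_trans _ (rnormD _ _))// subrK.
Qed.

Lemma cvg_rnormP {T} {F : set_system T} {FF : Filter F} (f : T -> W) x :
  f @ F --> x <->
  forall e : R, 0 < e -> \forall t \near F, rnorm (x - f t) < e.
Proof.
split.
  move=> /cvgrPdist_lt h e e0; have /h : (0 : R[i]) < e%:C by rewrite ltcR.
  by apply: filterS => t; rewrite rnormE ltcR.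
move=> h; apply/cvgrPdist_lt => -[e e'] /=; rewrite ltcE /= => /andP[/eqP -> /h].
by apply: filterS => t; rewrite rnormE -ltcR.
Qed.

Lemma rnorm_lim_le {T} {F : set_system T} {FF : ProperFilter F} (f : T -> W) x y c :
  f @ F --> x -> (\forall t \near F, rnorm (f t - y) <= c) -> rnorm (x - y) <= c.
Proof.
move=> /cvg_rnormP fx fc; apply/ler_addgt0Pr => e e0.
have [t [h1 h2]] := filter_ex (filterI (fx e e0) fc).
by have := rnormD (x - f t) (f t - y); rewrite addrA subrK; lra.
Qed.

End RealNorm.

Section Summable.
Context {R : realType} {W : completeNormedModType R[i]}.
Implicit Types (u : nat -> W) (v : nat -> R).

Lemma dominated_series_cvg u v m : (forall n, rnorm (u n) <= v n) ->
  (forall n, series v n <= m) -> cvgn (series u).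
Proof.
move=> uv vm.
have v0 n : 0 <= v n by apply: le_trans (uv n); exact: rnorm_ge0.
have : cvgn (series v).
  apply: nondecreasing_is_cvgn; first exact: nondecreasing_series.
  by exists m => _ [n _ <-].
move=> /cauchy_cvgP/cauchy_seriesP cv.
apply/cauchy_cvgP/cauchy_seriesP => -[e e'] /=; rewrite ltcE /= => /andP[/eqP -> e0].
apply: filterS (cv e e0) => n h; rewrite rnormE ltcR.
apply: le_lt_trans h; apply: le_trans (rnorm_sum _ _ _) _.
apply: le_trans (ler_norm _); exact: ler_sum.
Qed.

Lemma dominated_series_le u v l m : (forall n, rnorm (u n) <= v n) ->
  (forall n, series v n <= m) -> series u @ \oo --> l -> rnorm l <= m.
Proof.
move=> uv vm ul; rewrite -[l]subr0; apply: (rnorm_lim_le ul).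
apply: nearW => n; rewrite subr0; apply: le_trans (vm n).
by rewrite /series /= (le_trans (rnorm_sum _ _ _))// ler_sum.
Qed.

End Summable.

Section RealLemmas.
Context {R : realType}.
Implicit Types (G : R -> R) (r s t : R).

(** A Dini-derivative form of the mean value inequality.  The supremum [c] of
    the times [t] with [G t - G 0 <= e * t] is such a time, by the estimate to
    the left of [c], and is [1], by the estimate to the right. *)
Lemma dini_le G :
  (forall t e, 0 <= t <= 1 -> 0 < e -> exists2 d, 0 < d &
     forall s, 0 <= s <= 1 -> `|s - t| < d ->
       (t <= s -> G s - G t <= e * (s - t)) /\
       (s <= t -> G t - G s <= e * (t - s))) ->
  G 1 <= G 0.
Proof.
move=> h; apply/ler_addgt0Pr => e e0.
pose E : set R := [set t | 0 <= t <= 1 /\ G t - G 0 <= e * t].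
have E0 : E 0 by split; rewrite ?lexx ?ler01// mulr0 subrr.
have Eub : ubound E 1 by move=> t [/andP[]].
have supE : has_sup E by split; [exists 0|exists 1].
set c := sup E.
have c0 : 0 <= c by apply: ub_le_sup => //; exists 1.
have c1 : c <= 1 by apply: ge_sup => //; exists 0.
have c01 : 0 <= c <= 1 by rewrite c0.
have [d d0 hd] := h c e c01 e0.
have Ec : E c.
  have [t Et tc] := sup_adherent d0 supE; rewrite -/c in tc.
  have tlec : t <= c by apply: ub_le_sup => //; exists 1.
  have [] := hd t Et.1; first by rewrite ler0_norm ?subr_le0//; lra.
  by move=> _ /(_ tlec) h2; split=> //; have := Et.2; lra.
have [c_1|c_1] := ltP c 1; last first.
  have -> : 1 = c by apply: le_anti; rewrite c1 c_1.
  by have := Ec.2; nra.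
pose s := Num.min 1 (c + d / 2).
have cs : c < s by rewrite /s lt_min c_1 ltrDl divr_gt0.
have s01 : 0 <= s <= 1 by rewrite /s ge_min lexx andbT (ltW (le_lt_trans c0 cs)).
have sd : s <= c + d / 2 by rewrite /s ge_min lexx orbT.
have [] := hd s s01; first by rewrite gtr0_norm ?subr_gt0//; lra.
move=> /(_ (ltW cs)) h2 _.
suff : s <= c by rewrite leNgt cs.
apply: ub_le_sup; first by exists 1.
by split=> //; have := Ec.2; lra.
Qed.

Lemma dini_le_linear G m :
  (forall t e, 0 <= t <= 1 -> 0 < e -> exists2 d, 0 < d &
     forall s, 0 <= s <= 1 -> `|s - t| < d ->
       (t <= s -> G s - G t <= (m + e) * (s - t)) /\
       (s <= t -> G t - G s <= (m + e) * (t - s))) ->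
  G 1 <= G 0 + m.
Proof.
move=> h; have := @dini_le (fun t => G t - m * t).
rewrite mulr0 mulr1 subr0 lerBlDr; apply => t e t01 e0.
have [d d0 hd] := h t e t01 e0; exists d => // s s01 std.
have [h1 h2] := hd s s01 std; split=> ts; [have := h1 ts|have := h2 ts]; lra.
Qed.

(** For paths built from exponentials the expansions are explicit, and their
    remainders are quadratic. *)
Lemma quadratic_le_linear G m C :
  (forall s t, 0 <= t -> t <= s -> s <= 1 ->
     G s - G t <= m * (s - t) + C * (s - t) ^+ 2) -> G 1 <= G 0 + m.
Proof.
move=> h; apply: dini_le_linear => t e t01 e0.
have c0 : 0 < `|C| + 1 by rewrite ltr_wpDl.
exists (e / (`|C| + 1)) => [|s s01]; first by rewrite divr_gt0.
rewrite ltr_pdivlMr// => hd.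
have key a b : 0 <= a - b -> (a - b) * (`|C| + 1) < e ->
    m * (a - b) + C * (a - b) ^+ 2 <= (m + e) * (a - b).
  move=> ab he; rewrite mulrDl lerD2l expr2 mulrA ler_wpM2r//.
  apply: le_trans (ltW he); rewrite mulrC ler_wpM2l//.
  by have := ler_norm C; lra.
have [/andP[s0 s1] /andP[t0 t1]] := (s01, t01).
split=> st; [apply: le_trans (h s t t0 st s1) _|apply: le_trans (h t s s0 st t1) _].
  by apply: key; rewrite ?subr_ge0// ger0_norm ?subr_ge0// in hd *.
by apply: key; rewrite ?subr_ge0// distrC ger0_norm ?subr_ge0// in hd *.
Qed.

Lemma quadratic_ge0_discr (a b c : R) : 0 <= c ->
  (forall t, 0 <= a + 2 * (t * b) + t ^+ 2 * c) -> b ^+ 2 <= a * c.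
Proof.
move=> c0 h; have [c_0|cn0] := eqVneq c 0.
  have [->|bn0] := eqVneq b 0; first by rewrite c_0; lra.
  have := h (- (a + 1) / (2 * b)); rewrite c_0 mulr0 addr0.
  have -> : a + 2 * (- (a + 1) / (2 * b) * b) = -1 by field.
  by rewrite oppr_ge0 ler10.
have cp : 0 < c by rewrite lt_def cn0.
have := h (- b / c).
have -> : a + 2 * (- b / c * b) + (- b / c) ^+ 2 * c = (a * c - b ^+ 2) / c.
  by field.
by rewrite pmulr_lge0 ?invr_gt0// subr_ge0.
Qed.

Lemma series_exp_coeff_le (a : R) n : 0 <= a -> series (exp_coeff a) n <= expR a.
Proof.
move=> a0; apply: nondecreasing_cvgn_le; last exact: is_cvg_series_exp_coeff.
by apply: nondecreasing_series => k _ _; exact: exp_coeff_ge0.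
Qed.

Lemma series_geometric_le (r : R) n : 0 <= r < 1 ->
  series (fun k => r ^+ k) n <= (1 - r)^-1.
Proof.
move=> /andP[r0 r1]; have h : 0 < 1 - r by lra.
rewrite -[leRHS]mul1r ler_pdivlMr//.
suff -> : series (fun k => r ^+ k) n * (1 - r) = 1 - r ^+ n.
  by have := exprn_ge0 n r0; lra.
rewrite /series /=; elim: n => [|n ih]; first by rewrite big_geq// expr0; lra.
by rewrite big_nat_recr//= mulrDl ih exprS; ring.
Qed.

Lemma series_arith_geometric_le (r : R) n : 0 <= r < 1 ->
  series (fun k => k.+1%:R * r ^+ k) n <= (1 - r) ^- 2.
Proof.
move=> /andP[r0 r1]; have h : 0 < 1 - r by lra.
rewrite -[leRHS]mul1r ler_pdivlMr ?exprn_gt0//.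
suff -> : series (fun k => k.+1%:R * r ^+ k) n * (1 - r) ^+ 2 =
    1 - r ^+ n * (1 + n%:R * (1 - r)).
  suff : 0 <= r ^+ n * (1 + n%:R * (1 - r)) by lra.
  by rewrite mulr_ge0 ?exprn_ge0// addr_ge0// mulr_ge0// ltW.
rewrite /series /=; elim: n => [|n ih]; first by rewrite big_geq// expr0; lra.
by rewrite big_nat_recr//= mulrDl ih [r ^+ n.+1]exprS -natr1; ring.
Qed.

End RealLemmas.

(** * The algebra of operators as a normed ring with involution *)

Section RingOfOperators.
Context {R : realType} {V : hilbertType R} {A : vonNeumannType V}.
Implicit Types (x y z : A) (u v : V) (c : R[i]) (t : R).

Lemma op_ext x y : (forall u : V, rep x u = rep y u) -> x = y.
Proof.
move=> e; apply/subr0_eq; apply/normr0_eq0/le_anti; rewrite normr_ge0 andbT.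
apply: rep_norm_min => // u.
rewrite -[x - y]/(x + - y) -(scaleN1r y) addrC repP e scaleN1r addNr normr0.
by rewrite mul0r.
Qed.

Lemma repD x y u : rep (x + y) u = rep x u + rep y u.
Proof. by rewrite -[x]scale1r repP !scale1r. Qed.

Lemma repZ c x u : rep (c *: x) u = c *: rep x u.
Proof.
have r0 : rep (0 : A) u = 0 by apply: (addrI (rep (0 : A) u)); rewrite -repD !addr0.
by rewrite -[c *: x]addr0 repP r0 addr0.
Qed.

Lemma op_mulA : associative (@op_mul R V A).
Proof. by move=> x y z; apply: op_ext => u; rewrite !repM. Qed.

Lemma op_mul1 : left_id op_one (@op_mul R V A).
Proof. by move=> x; apply: op_ext => u; rewrite !repM rep1. Qed.

Lemma op_1mul : right_id op_one (@op_mul R V A).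
Proof. by move=> x; apply: op_ext => u; rewrite !repM rep1. Qed.

Lemma op_mulDl : left_distributive (@op_mul R V A) +%R.
Proof. by move=> x y z; apply: op_ext => u; rewrite !(repM,repD). Qed.

Lemma op_mulDr : right_distributive (@op_mul R V A) +%R.
Proof. by move=> x y z; apply: op_ext => u; rewrite !(repM,repD) linearD. Qed.

(* When [V] is the zero space this ring is trivial; the scalars therefore act on
   it through [op_scaleAl] and [op_scaleAr] below and not through an algebra
   structure, which would require [1 != 0]. *)
HB.instance Definition _ := GRing.Zmodule_isPzRing.Build A
  op_mulA op_mul1 op_1mul op_mulDl op_mulDr.

End RingOfOperators.

Section Operators.
Context {R : realType} {V : hilbertType R} {A : vonNeumannType V}.
Implicit Types (x y z : A) (u v : V) (c : R[i]) (t : R).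

Lemma op_scaleAl c x y : (c *: x) * y = c *: (x * y).
Proof. by apply: op_ext => u; rewrite !(repM,repZ). Qed.

Lemma op_scaleAr c x y : x * (c *: y) = c *: (x * y).
Proof. by apply: op_ext => u; rewrite !(repM,repZ) linearZ. Qed.

Lemma op_exprZ c x n : (c *: x) ^+ n = c ^+ n *: x ^+ n.
Proof.
elim: n => [|n ih]; first by rewrite !expr0 scale1r.
by rewrite !exprS ih op_scaleAl op_scaleAr scalerA.
Qed.

Lemma iter_op_mul x n : iter n (op_mul x) op_one = x ^+ n.
Proof. by elim: n => //= n ->; rewrite exprS. Qed.

(** The inner product as a plain function, free of the bundled bilinear and
    sesquilinear structures through which [dot] is applied. *)
Definition idot u v : R[i] := dot u v.

Lemma idotC u v : idot u v = (idot v u)^*.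
Proof. by rewrite /idot hermC expr0 mul1r. Qed.

Lemma idotDl u v w : idot (u + v) w = idot u w + idot v w.
Proof. by rewrite /idot linearDl. Qed.

Lemma idotZl c u v : idot (c *: u) v = c * idot u v.
Proof. by rewrite /idot linearZl_LR. Qed.

Lemma idotDr u v w : idot w (u + v) = idot w u + idot w v.
Proof. by rewrite idotC idotDl rmorphD /= -!idotC. Qed.

Lemma idotZr c u v : idot u (c *: v) = c^* * idot u v.
Proof. by rewrite idotC idotZl rmorphM /= -idotC. Qed.

Lemma idot_rep x u v : idot (rep x u) v = idot u (rep (star x) v).
Proof. exact: rep_star. Qed.

Definition rdot u v : R := complex.Re (idot u v).

Lemma ReC c : complex.Re c^* = complex.Re c.
Proof. by case: c. Qed.

Lemma rdotC u v : rdot u v = rdot v u.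
Proof. by rewrite /rdot idotC ReC. Qed.

Lemma rdotDl u v w : rdot (u + v) w = rdot u w + rdot v w.
Proof. by rewrite /rdot idotDl raddfD. Qed.

Lemma ReZ t c : complex.Re (t%:C * c) = t * complex.Re c.
Proof. by case: c => a b /=; rewrite mul0r subr0. Qed.

Lemma rdotZl t u v : rdot (t *r u) v = t * rdot u v.
Proof. by rewrite /rdot idotZl ReZ. Qed.

Lemma rdot_sqr u : rdot u u = rnorm u ^+ 2.
Proof. by rewrite /rdot /idot -sqr_norm_dot rnormE -rmorphXn. Qed.

Lemma rdot_rep x u v : rdot (rep x u) v = rdot u (rep (star x) v).
Proof. by rewrite /rdot idot_rep. Qed.

End Operators.

Section CauchySchwarz.
Context {R : realType} {W : lmodType R[i]} (g : W -> W -> R).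
Hypothesis gC : forall x y, g x y = g y x.
Hypothesis gD : forall x y z, g (x + y) z = g x z + g y z.
Hypothesis gZ : forall t x y, g (t *r x) y = t * g x y.
Hypothesis g0 : forall x, 0 <= g x x.

Lemma real_form_CS x y : g x y ^+ 2 <= g x x * g y y.
Proof.
apply: quadratic_ge0_discr => // t.
have -> : g x x + 2 * (t * g x y) + t ^+ 2 * g y y = g (x + t *r y) (x + t *r y).
  by rewrite gD gZ (gC x (_ + _)) gD gZ (gC y (_ + _)) gD gZ (gC y x); ring.
exact: g0.
Qed.

Lemma real_form_CS_sqrt x y : g x y <= Num.sqrt (g x x) * Num.sqrt (g y y).
Proof.
rewrite -sqrtrM// (le_trans (ler_norm _))// -sqrtr_sqr ler_wsqrtr//.
exact: real_form_CS.
Qed.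

End CauchySchwarz.

Section Star.
Context {R : realType} {V : hilbertType R} {A : vonNeumannType V}.
Implicit Types (x y z : A) (u v : V) (c : R[i]) (t : R).

Lemma rdot_le u v : rdot u v <= rnorm u * rnorm v.
Proof.
have := real_form_CS_sqrt (@rdotC _ V) (@rdotDl _ V) (@rdotZl _ V) _ u v.
rewrite !rdot_sqr !sqrtr_sqr !ger0_norm ?rnorm_ge0//; apply => w.
by rewrite rdot_sqr sqr_ge0.
Qed.

Lemma idot_ext x y : (forall u v, idot (rep x u) v = idot (rep y u) v) -> x = y.
Proof.
move=> e; apply: op_ext => u; apply/subr0_eq/rnorm_eq0.
have : rnorm (rep x u - rep y u) ^+ 2 = 0.
  by rewrite -rdot_sqr /rdot -scaleN1r idotDl idotZl e mulN1r subrr.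
by move=> /eqP; rewrite expf_eq0 => /eqP.
Qed.

Lemma idot_rep_star x u v : idot (rep (star x) u) v = idot u (rep x v).
Proof. by rewrite idotC -idot_rep -idotC. Qed.

Lemma starK : involutive (@star R V A).
Proof. by move=> x; apply: idot_ext => u v; rewrite idot_rep_star -idot_rep. Qed.

Lemma starD x y : star (x + y) = star x + star y.
Proof.
apply: idot_ext => u v.
by rewrite idot_rep_star !repD idotDl idotDr !idot_rep_star.
Qed.

Lemma starM x y : star (x * y) = star y * star x.
Proof. by apply: idot_ext => u v; rewrite idot_rep_star !repM !idot_rep_star. Qed.

Lemma starZ c x : star (c *: x) = c^* *: star x.
Proof.
apply: idot_ext => u v.
by rewrite idot_rep_star !repZ idotZr idotZl idot_rep_star.
Qed.

Lemma starZr t x : star (t *r x) = t *r star x.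
Proof. by rewrite starZ; congr (_ *: _); exact: conjc_real. Qed.

Lemma star1 : star (1 : A) = 1.
Proof. by rewrite -[star 1]mulr1 -{2}(starK 1) -starM mulr1 starK. Qed.

Lemma starX x n : star (x ^+ n) = star x ^+ n.
Proof. by elim: n => [|n ih]; rewrite ?star1// exprSr starM ih exprS. Qed.

Lemma starN x : star (- x) = - star x.
Proof. by rewrite -scaleN1r starZ rmorphN1 scaleN1r. Qed.

Lemma starB x y : star (x - y) = star x - star y.
Proof. by rewrite starD starN. Qed.

Lemma rep_rnorm_le x u : rnorm (rep x u) <= rnorm x * rnorm u.
Proof. by rewrite -lecR rmorphM /= -!rnormE rep_norm_le. Qed.

Lemma rnorm_min x (a : R) : 0 <= a ->
  (forall u, rnorm (rep x u) <= a * rnorm u) -> rnorm x <= a.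
Proof.
move=> a0 h; rewrite -lecR -rnormE; apply: rep_norm_min => [|u].
  by rewrite ler0c.
by rewrite !rnormE -rmorphM lecR.
Qed.

Lemma rnormM x y : rnorm (x * y) <= rnorm x * rnorm y.
Proof.
apply: rnorm_min => [|u]; first by rewrite mulr_ge0 ?rnorm_ge0.
rewrite repM (le_trans (rep_rnorm_le _ _))// -mulrA ler_wpM2l ?rnorm_ge0//.
exact: rep_rnorm_le.
Qed.

Lemma rnorm1_le : rnorm (1 : A) <= 1.
Proof. by apply: rnorm_min => // u; rewrite rep1 mul1r. Qed.

Lemma rnormX x n : rnorm (x ^+ n) <= rnorm x ^+ n.
Proof.
elim: n => [|n ih]; first exact: rnorm1_le.
by rewrite !exprS (le_trans (rnormM _ _))// ler_wpM2l ?rnorm_ge0.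
Qed.

Lemma rnormM3 x y z : rnorm (x * y * z) <= rnorm x * rnorm y * rnorm z.
Proof.
by rewrite (le_trans (rnormM _ _))// ler_wpM2r ?rnorm_ge0// rnormM.
Qed.

Lemma rnorm_star x : rnorm (star x) = rnorm x.
Proof.
suff h y : rnorm (star y) <= rnorm y by apply: le_anti; rewrite h -{1}(starK x) h.
apply: rnorm_min => [|u]; first exact: rnorm_ge0.
have [->|n0] := eqVneq (rnorm (rep (star y) u)) 0; first by rewrite mulr_ge0 ?rnorm_ge0.
have np : 0 < rnorm (rep (star y) u) by rewrite lt_def n0 rnorm_ge0.
rewrite -(ler_pM2l np) -expr2 -rdot_sqr -{1}(starK y) -rdot_rep starK.
rewrite (le_trans (rdot_le _ _))// [leRHS]mulrCA mulrA ler_wpM2r ?rnorm_ge0//.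
exact: rep_rnorm_le.
Qed.

Lemma cvgM_op {T} {F : set_system T} {FF : Filter F} (f g : T -> A) x y :
  f @ F --> x -> g @ F --> y -> (fun i => f i * g i) @ F --> x * y.
Proof.
move=> /cvg_rnormP fx /cvg_rnormP gy; apply/cvg_rnormP => e e0.
have a0 := rnorm_ge0 x; have b0 := rnorm_ge0 y.
pose d := Num.min 1 (e / (rnorm x + rnorm y + 1)).
have d0 : 0 < d by rewrite lt_min ltr01 divr_gt0// ltr_wpDl// addr_ge0.
have [d1 d2] : d <= 1 /\ d * (rnorm x + rnorm y + 1) <= e.
  by split; rewrite -?ler_pdivlMr ?ge_min ?lexx ?orbT//; lra.
apply: filterS2 (fx d d0) (gy d d0) => i h1 h2.
have -> : x * y - f i * g i = x * (y - g i) + (x - f i) * (y - (y - g i)).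
  by rewrite subKr mulrBr mulrBl addrA subrK.
apply: le_lt_trans (rnormD _ _) _.
have h3 := rnormM x (y - g i); have h4 := rnormM (x - f i) (y - (y - g i)).
have h5 := rnormB y (y - g i).
have c1 := rnorm_ge0 (y - g i); have c2 := rnorm_ge0 (x - f i).
set p := rnorm (x - f i) in h1 h4 c2 *; set q := rnorm (y - g i) in h2 h3 h5 c1 *.
have h6 : p * rnorm (y - (y - g i)) <= p * (rnorm y + q) by rewrite ler_wpM2l.
have h7 : rnorm x * q <= rnorm x * d by rewrite ler_wpM2l// ltW.
have h8 : p * (rnorm y + q) < d * (rnorm y + 1).
  apply: le_lt_trans (_ : p * (rnorm y + 1) < _); first by rewrite ler_wpM2l//; lra.
  by rewrite ltr_pM2r//; lra.
lra.
Qed.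

Lemma cvg_star {T} {F : set_system T} {FF : Filter F} (f : T -> A) x :
  f @ F --> x -> (fun i => star (f i)) @ F --> star x.
Proof.
move=> /cvg_rnormP fx; apply/cvg_rnormP => e e0; apply: filterS (fx e e0) => t.
by rewrite -starB rnorm_star.
Qed.

Lemma op_cvg_unique {T} {F : set_system T} {FF : ProperFilter F} (f : T -> A) x y :
  f @ F --> x -> f @ F --> y -> x = y.
Proof. by apply: cvg_unique; exact: norm_hausdorff. Qed.

Lemma comm_cvg {T} {F : set_system T} {FF : ProperFilter F} (f : T -> A) x y :
  f @ F --> y -> (forall i, GRing.comm x (f i)) -> GRing.comm x y.
Proof.
move=> fy c; have h1 : (fun i => x * f i) @ F --> x * y.
  by apply: cvgM_op => //; exact: cvg_cst.
have h2 : (fun i => f i * x) @ F --> y * x.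
  by apply: cvgM_op => //; exact: cvg_cst.
rewrite (_ : (fun i => _) = (fun i => x * f i)) in h2.
  exact: op_cvg_unique h1 h2.
by apply/funext => i; rewrite c.
Qed.

Lemma rnorm_subX (m : R) x y n : rnorm x <= m -> rnorm y <= m ->
  rnorm (x ^+ n.+1 - y ^+ n.+1) <= n.+1%:R * m ^+ n * rnorm (x - y).
Proof.
move=> xm ym; have m0 : 0 <= m by apply: le_trans xm; exact: rnorm_ge0.
elim: n => [|n ih]; first by rewrite !expr1 expr0 !mul1r.
have -> : x ^+ n.+2 - y ^+ n.+2 = x * (x ^+ n.+1 - y ^+ n.+1) + (x - y) * y ^+ n.+1.
  by rewrite mulrBr mulrBl -!exprS addrA subrK.
apply: (le_trans (rnormD _ _)).
have h1 : rnorm (x * (x ^+ n.+1 - y ^+ n.+1)) <= m * (n.+1%:R * m ^+ n * rnorm (x - y)).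
  by rewrite (le_trans (rnormM _ _))// ler_pM ?rnorm_ge0.
have h2 : rnorm ((x - y) * y ^+ n.+1) <= rnorm (x - y) * m ^+ n.+1.
  rewrite (le_trans (rnormM _ _))// ler_wpM2l ?rnorm_ge0// (le_trans (rnormX _ _))//.
  by rewrite lerXn2r ?nnegrE ?rnorm_ge0.
apply: le_trans (lerD h1 h2) _; rewrite -(natr1 n.+1) exprS.
by set N := n.+1%:R; lra.
Qed.

End Star.

(** * The exponential series *)

(** The remainder is a sum of products with nonnegative coefficients, so that for
    the exponential series it is dominated by the same remainder for the real
    exponentials of the norms, which tends to [0]. *)
Lemma cauchy_product_remainder (T : pzRingType) (p q r : nat -> T) n :
  (forall m, r m = \sum_(i < m.+1) p i * q (m - i)%N) ->
  (\sum_(i < n) p i) * (\sum_(j < n) q j) - \sum_(m < n) r m =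
  \sum_(i < n) \sum_(j < n | (n <= i + j)%N) p i * q j.
Proof.
move=> er.
have -> : \sum_(m < n) r m = \sum_(i < n) \sum_(j < n | ~~ (n <= i + j)%N) p i * q j.
  transitivity (\sum_(m < n) \sum_(i < n | (i <= m)%N) p i * q (m - i)%N).
    apply: eq_bigr => m _; rewrite er.
    rewrite (big_ord_widen_cond n xpredT (fun i => p i * q (m - i)%N))//.
  rewrite (exchange_big_dep xpredT)//=; apply: eq_bigr => i _.
  rewrite [RHS](eq_bigl (fun j : 'I_n => (j < n - i)%N)); last first.
    by move=> j; rewrite -ltnNge ltn_subRL.
  rewrite -(big_ord_widen_cond n xpredT (fun j => p i * q j)) ?leq_subr//=.
  rewrite -(big_mkord (fun m => (i <= m)%N) (fun m => p i * q (m - i)%N)).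
  rewrite -(big_mkord xpredT (fun j => p i * q j)).
  rewrite -{2}[nat_of_ord i]add0n.
  rewrite (big_cat_nat (n := i)) ?leq0n ?(ltnW (ltn_ord i))//=.
  rewrite big_nat_cond big1 ?add0r; last by move=> j /andP[/andP[_ ji]]; rewrite leqNgt ji.
  rewrite -{1}[nat_of_ord i]add0n big_addn big_nat_cond [RHS]big_nat_cond.
  apply: eq_big => j; first by rewrite leq_addl !andbT.
  by rewrite addnK.
rewrite mulr_suml -sumrB; apply: eq_bigr => i _.
rewrite mulr_sumr (bigID (fun j : 'I_n => (n <= i + j)%N))/=.
by rewrite addrK.
Qed.

Lemma invf_fact_bin (F : numFieldType) m i : (i <= m)%N ->
  (m`!%:R^-1 * 'C(m, i)%:R : F) = i`!%:R^-1 * (m - i)`!%:R^-1.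
Proof.
move=> im; have nz k : k`!%:R != 0 :> F by rewrite pnatr_eq0 -lt0n fact_gt0.
by apply: (mulfI (nz m)); rewrite mulrA divff// mul1r -(bin_fact im) !natrM; field;
  rewrite !nz.
Qed.

Lemma exp_coeffD (R : realType) (a b : R) m :
  exp_coeff (a + b) m = \sum_(i < m.+1) exp_coeff a i * exp_coeff b (m - i)%N.
Proof.
rewrite /exp_coeff /= addrC exprDn mulr_suml; apply: eq_bigr => i _.
have im : (i <= m)%N by rewrite -ltnS.
rewrite -mulr_natr -(mulrA _ _ m`!%:R^-1) (mulrC 'C(m, i)%:R) invf_fact_bin//.
by set c := _^-1; set d := _^-1; ring.
Qed.

Section Exponential.
Context {R : realType} {V : hilbertType R} {A : vonNeumannType V}.
Implicit Types (x y z : A) (t : R).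

Definition exp_term x n : A := n`!%:R^-1 *r x ^+ n.

Lemma expA_series x : expA x = limn (series (exp_term x)).
Proof.
congr (limn (series _)); apply/funext => n.
by rewrite /exp_term fmorphV rmorph_nat iter_op_mul.
Qed.

Lemma rnorm_exp_term x n : rnorm (exp_term x n) <= exp_coeff (rnorm x) n.
Proof.
rewrite /exp_term rnormZ ger0_norm ?invr_ge0// /exp_coeff /= mulrC.
by rewrite ler_wpM2r ?invr_ge0// rnormX.
Qed.

Lemma expA_cvg x : series (exp_term x) @ \oo --> expA x.
Proof.
rewrite expA_series; have vm n := series_exp_coeff_le n (rnorm_ge0 x).
exact: dominated_series_cvg (rnorm_exp_term x) vm.
Qed.

Lemma rnorm_expA x : rnorm (expA x) <= expR (rnorm x).
Proof.
apply: (dominated_series_le (rnorm_exp_term x) _ (@expA_cvg x)) => n.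
by rewrite series_exp_coeff_le ?rnorm_ge0.
Qed.

Lemma exp_termD x y m : GRing.comm x y ->
  exp_term (x + y) m = \sum_(i < m.+1) exp_term x i * exp_term y (m - i)%N.
Proof.
move=> xy; rewrite /exp_term addrC exprDn_comm; last exact: commr_sym.
rewrite scaler_sumr; apply: eq_bigr => i _.
have im : (i <= m)%N by rewrite -ltnS.
rewrite op_scaleAl op_scaleAr scalerA -rmorphM -invf_fact_bin//.
rewrite rmorphM -scalerA rmorph_nat scaler_nat; congr (_ *: (_ *+ _)).
exact/commrX/commr_sym/commrX/commr_sym.
Qed.

Lemma expAD x y : GRing.comm x y -> expA (x + y) = expA x * expA y.
Proof.
move=> xy.
have h1 : (fun n => series (exp_term x) n * series (exp_term y) n) @ \oo
  --> expA x * expA y by apply: cvgM_op; exact: expA_cvg.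
have h2 := @expA_cvg (x + y).
apply/esym/(op_cvg_unique h1)/cvg_rnormP => e e0.
set a := rnorm x; set b := rnorm y.
have h3 : (series (exp_coeff a) n * series (exp_coeff b) n -
    series (exp_coeff (a + b)) n) @[n --> \oo] --> (0 : R).
  rewrite -(subrr (expR (a + b))) {1}expRD.
  by apply: cvgB; [apply: cvgM|]; exact: is_cvg_series_exp_coeff.
have e20 : 0 < e / 2 by rewrite divr_gt0.
move/cvgrPdist_lt: h3 => /(_ _ e20) h3; move/cvg_rnormP: h2 => /(_ _ e20) h2.
apply: filterS2 h3 h2 => n; rewrite sub0r normrN => h3 h2.
have h4 : rnorm (series (exp_term x) n * series (exp_term y) n -
    series (exp_term (x + y)) n) <= e / 2.
  apply: le_trans (ltW h3); apply: le_trans (ler_norm _).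
  rewrite /series /= !big_mkord.
  rewrite (cauchy_product_remainder n (fun m => exp_termD m xy)).
  rewrite (cauchy_product_remainder n (exp_coeffD a b)).
  apply: le_trans (rnorm_sum _ _ _) _; apply: ler_sum => i _.
  apply: le_trans (rnorm_sum _ _ _) _; apply: ler_sum => j _.
  by apply: le_trans (rnormM _ _) _; rewrite ler_pM ?rnorm_ge0// rnorm_exp_term.
have := rnormB (expA (x + y) - series (exp_term (x + y)) n)
  (series (exp_term x) n * series (exp_term y) n - series (exp_term (x + y)) n).
by rewrite opprB addrA subrK; lra.
Qed.

Lemma expA0 : expA 0 = 1 :> A.
Proof.
apply: (op_cvg_unique (@expA_cvg 0)); apply/cvg_rnormP => e e0; near=> n.
have [m ->] : exists m, n = m.+1 by exists n.-1; rewrite prednK//; near: n; exists 1%N.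
rewrite /series /= big_nat_recl//= /exp_term big1 ?addr0.
  by rewrite fact0 invr1 expr0 scale1r subrr rnorm0.
by move=> i _; rewrite expr0n scaler0.
Unshelve. all: by end_near. Qed.

Lemma expA_scalar t : expA (t *r (1 : A)) = expR t *r (1 : A).
Proof.
apply: (op_cvg_unique (@expA_cvg _)); apply/cvg_rnormP => e e0.
have /cvgrPdist_lt/(_ e e0) := @is_cvg_series_exp_coeff _ t.
apply: filterS => n h; 
have -> : series (exp_term (t *r (1 : A))) n = series (exp_coeff t) n *r (1 : A).
  rewrite /series /= rmorph_sum scaler_suml; apply: eq_bigr => i _.
  by rewrite /exp_term op_exprZ expr1n scalerA /exp_coeff /= -rmorphXn -rmorphM mulrC.
rewrite -scalerBl -rmorphB rnormZ; apply: le_lt_trans h.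
by rewrite -[leRHS]mulr1 ler_wpM2l// rnorm1_le.
Qed.

Lemma expA_mulN x : expA x * expA (- x) = 1.
Proof. by rewrite -expAD ?subrr ?expA0//; apply: commrN. Qed.

Lemma expA_Nmul x : expA (- x) * expA x = 1.
Proof. by have := expA_mulN (- x); rewrite opprK. Qed.

Lemma star_expA x : star (expA x) = expA (star x).
Proof.
apply: (op_cvg_unique (cvg_star (@expA_cvg x))).
rewrite (_ : (fun i => _) = series (exp_term (star x))); first exact: expA_cvg.
apply/funext => n; rewrite /series /=.
elim/big_rec2: _ => [|i y1 y2 _ <-]; first by rewrite -(scale0r 0) starZ rmorph0 !scale0r.
by rewrite starD /exp_term starZr starX.
Qed.

Lemma comm_expA x y : GRing.comm x y -> GRing.comm x (expA y).
Proof.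
move=> xy; apply: (comm_cvg (@expA_cvg y)) => n; apply/commr_sum => i _.
by rewrite /GRing.comm /exp_term op_scaleAl op_scaleAr; congr (_ *: _); exact: commrX.
Qed.

(** The remainder of the exponential beyond its linear part is a multiple of [x]
    in the algebra, so that both the norm and the trace norm of that remainder
    can be estimated. *)
Lemma expA_expand x : exists2 y, expA x = 1 + x + x * y &
  rnorm y <= rnorm x * expR (rnorm x).
Proof.
pose u n : A := n.+2`!%:R^-1 *r x ^+ n.+1.
have uv n : rnorm (u n) <= rnorm x * exp_coeff (rnorm x) n.
  rewrite /u rnormZ ger0_norm ?invr_ge0// /exp_coeff /= mulrC mulrA -exprS.
  rewrite ler_pM ?rnorm_ge0 ?invr_ge0 ?rnormX//.
  by rewrite lef_pV2 ?posrE ?ltr0n ?fact_gt0// ler_nat leq_fact// leqW.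
have vm n : series (fun n => rnorm x * exp_coeff (rnorm x) n) n <=
    rnorm x * expR (rnorm x).
  rewrite /series /= -mulr_sumr ler_wpM2l ?rnorm_ge0//.
  by rewrite series_exp_coeff_le ?rnorm_ge0.
have cu := dominated_series_cvg uv vm;
exists (limn (series u)); last exact: (dominated_series_le uv vm cu).
apply: (op_cvg_unique (@expA_cvg x)).
rewrite -(@cvg_shiftn 2).
rewrite (_ : (fun n => _) = (fun n => 1 + x + x * series u n)).
  by apply: cvgD; [exact: cvg_cst|apply: cvgM_op => //; exact: cvg_cst].
apply/funext => n; rewrite /series /= addnC big_nat_recl// big_nat_recl//= addrA.
congr (_ + _ + _); first by rewrite /exp_term fact0 invr1 expr0 scale1r.
  by rewrite /exp_term factS fact0 invr1 expr1 scale1r.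
rewrite mulr_sumr; apply: eq_bigr => i _.
by rewrite /exp_term /u op_scaleAr -exprS.
Qed.

Lemma expA_lipschitz (m : R) x y : rnorm x <= m -> rnorm y <= m ->
  rnorm (expA x - expA y) <= expR m * rnorm (x - y).
Proof.
move=> xm ym; have m0 : 0 <= m by apply: le_trans xm; exact: rnorm_ge0.
pose u n := exp_term x n.+1 - exp_term y n.+1.
have uv n : rnorm (u n) <= rnorm (x - y) * exp_coeff m n.
  rewrite /u /exp_term -scalerBr rnormZ ger0_norm ?invr_ge0//.
  apply: le_trans (ler_wpM2l _ (rnorm_subX n xm ym)) _; rewrite ?invr_ge0//.
  have nz : n.+1%:R != 0 :> R by rewrite pnatr_eq0.
  rewrite /exp_coeff /= factS natrM invfM [n.+1%:R^-1 * _]mulrC !mulrA mulfVK//.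
  by set c := _^-1; lra.
have vm n : series (fun n => rnorm (x - y) * exp_coeff m n) n <= expR m * rnorm (x - y).
  rewrite /series /= -mulr_sumr mulrC ler_wpM2r ?rnorm_ge0//.
  exact: series_exp_coeff_le.
apply: (dominated_series_le uv vm).
have h := cvgB (@expA_cvg x) (@expA_cvg y); rewrite -(@cvg_shiftn 1) in h.
rewrite (_ : series u = fun n => series (exp_term x) (n + 1)%N - series (exp_term y) (n + 1)%N);
  first exact: h.
apply/funext => n; rewrite /series /= addn1 !big_nat_recl//= /u sumrB /exp_term.
by rewrite !expr0 opprD addrACA subrr add0r.
Qed.

End Exponential.

(** * The logarithm of [1 - z] *)

Section Logarithm.
Context {R : realType} {V : hilbertType R} {A : vonNeumannType V}.
Implicit Types (x y z : A) (s t : R).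

Lemma quadratic_increments_eq (f : R -> A) (C : R) :
  (forall s t, 0 <= s <= 1 -> 0 <= t <= 1 -> rnorm (f s - f t) <= C * (s - t) ^+ 2) ->
  f 1 = f 0.
Proof.
move=> h; apply/subr0_eq/rnorm_eq0/le_anti; rewrite rnorm_ge0 andbT.
have := @quadratic_le_linear R (fun t => rnorm (f t - f 0)) 0 C.
rewrite subrr rnorm0 addr0; apply => s t t0 st s1; rewrite mul0r add0r.
apply: le_trans (h s t _ _); rewrite ?t0 ?s1 ?(le_trans t0 st) ?(le_trans st s1)//.
apply: le_trans (ler_norm _) _; apply: le_trans (rnorm_dist _ _) _.
by rewrite opprB addrA subrK.
Qed.

Definition log_term z n : A := n.+1%:R^-1 *r z ^+ n.+1.

(** The Mercator series: [mercator z] is minus the logarithm of [1 - z]. *)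
Definition mercator z : A := limn (series (log_term z)).

Variable r : R.
Hypothesis r01 : 0 <= r < 1.
Let r0 : 0 <= r. Proof. by case/andP: r01. Qed.
Let r1 : r < 1. Proof. by case/andP: r01. Qed.
Let q0 : 0 < 1 - r. Proof. by rewrite subr_gt0. Qed.

Lemma rnorm_log_term_sub x y n : rnorm x <= r -> rnorm y <= r ->
  rnorm (log_term x n - log_term y n) <= rnorm (x - y) * r ^+ n.
Proof.
move=> xr yr; rewrite /log_term -scalerBr rnormZ ger0_norm ?invr_ge0//.
rewrite ler_pdivrMl ?ltr0n// (le_trans (rnorm_subX n xr yr))//.
by rewrite -mulrA [r ^+ n * _]mulrC.
Qed.

Lemma mercator_cvg z : rnorm z <= r -> series (log_term z) @ \oo --> mercator z.
Proof.
move=> zr; have uv n : rnorm (log_term z n) <= 1 * r ^+ n.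
  have e0 : log_term (0 : A) n = 0 by rewrite /log_term exprS mul0r scaler0.
  rewrite -[log_term z n]subr0 -e0 (le_trans (rnorm_log_term_sub _ _ _)) ?rnorm0//.
  by rewrite subr0 ler_wpM2r ?exprn_ge0// (le_trans zr)// ltW.
have vm n : series (fun n => 1 * r ^+ n) n <= (1 - r)^-1.
  by rewrite /series /= -mulr_sumr mul1r series_geometric_le.
exact: dominated_series_cvg uv vm.
Qed.

Lemma mercator_lipschitz x y : rnorm x <= r -> rnorm y <= r ->
  rnorm (mercator x - mercator y) <= (1 - r)^-1 * rnorm (x - y).
Proof.
move=> xr yr; have uv n := rnorm_log_term_sub n xr yr.
have vm n : series (fun n => rnorm (x - y) * r ^+ n) n <= (1 - r)^-1 * rnorm (x - y).
  rewrite /series /= -mulr_sumr mulrC ler_wpM2r ?rnorm_ge0//.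
  exact: series_geometric_le.
apply: (dominated_series_le uv vm).
have h := cvgB (mercator_cvg xr) (mercator_cvg yr).
rewrite (_ : series _ = (fun n => series (log_term x) n - series (log_term y) n)).
  exact: h.
by apply/funext => n; rewrite /series /= sumrB.
Qed.

Lemma mercator0 : mercator 0 = 0.
Proof.
apply: (op_cvg_unique (mercator_cvg _)); first by rewrite rnorm0.
rewrite (_ : series _ = fun _ => 0); first exact: cvg_cst.
apply/funext => n; rewrite /series /= big1// => i _.
by rewrite /log_term exprS mul0r scaler0.
Qed.

Lemma comm_mercator x z : rnorm z <= r -> GRing.comm x z -> GRing.comm x (mercator z).
Proof.
move=> zr xz; apply: (comm_cvg (mercator_cvg zr)) => n; apply/commr_sum => i _.
by rewrite /GRing.comm /log_term op_scaleAl op_scaleAr; congr (_ *: _); exact: commrX.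
Qed.

Lemma star_mercator z : rnorm z <= r -> star (mercator z) = mercator (star z).
Proof.
move=> zr; have zr' : rnorm (star z) <= r by rewrite rnorm_star.
apply: (op_cvg_unique (cvg_star (mercator_cvg zr))).
rewrite (_ : (fun i => _) = series (log_term (star z))); first exact: mercator_cvg.
apply/funext => n; rewrite /series /=.
elim/big_rec2: _ => [|i y1 y2 _ <-]; first by rewrite -(scale0r 0) starZ rmorph0 !scale0r.
by rewrite starD /log_term starZr starX.
Qed.

Lemma taylor_power s t n : 0 <= s <= 1 -> 0 <= t <= 1 ->
  `|s ^+ n.+1 - t ^+ n.+1 - n.+1%:R * (s - t) * t ^+ n| <= n.+1%:R ^+ 2 * (s - t) ^+ 2.
Proof.
move=> /andP[s0 s1] /andP[t0 t1]; have q := sqr_ge0 (s - t).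
elim: n => [|n ih].
  by rewrite !expr1 expr0 mulr1 mul1r subrr normr0 expr1n mul1r.
have -> : s ^+ n.+2 - t ^+ n.+2 - n.+2%:R * (s - t) * t ^+ n.+1 =
    s * (s ^+ n.+1 - t ^+ n.+1 - n.+1%:R * (s - t) * t ^+ n) +
    n.+1%:R * (s - t) ^+ 2 * t ^+ n.
  by rewrite -(natr1 n.+1) !exprS; ring.
apply: le_trans (ler_normD _ _) _; rewrite normrM (ger0_norm s0).
have tn0 : 0 <= t ^+ n by rewrite exprn_ge0.
have tn1 : t ^+ n <= 1 by rewrite exprn_ile1.
rewrite [X in _ + X]ger0_norm; last by do 2 (apply: mulr_ge0 => //).
set N := n.+1%:R in ih *; rewrite -(natr1 n.+1) -/N.
have N0 : 0 <= N by [].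
set B := `|_| in ih *; have B0 : 0 <= B by exact: normr_ge0.
have h1 : s * B <= B by rewrite ler_piMl.
have h2 : N * (s - t) ^+ 2 * t ^+ n <= N * (s - t) ^+ 2.
  by rewrite ler_piMr// mulr_ge0.
have h3 : 0 <= (N + 1) * (s - t) ^+ 2 by rewrite mulr_ge0// addr_ge0.
lra.
Qed.

(** The derivative of [t |-> mercator (t z)] is the series of the
    [t ^+ n z ^+ n.+1], which is [z (1 - t z)^{-1}]; the error is quadratic term
    by term. *)
Lemma mercator_increment z s t : rnorm z <= r -> 0 <= s <= 1 -> 0 <= t <= 1 ->
  rnorm ((mercator (s *r z) - mercator (t *r z)) * (1 - t *r z) - (s - t) *r z)
  <= 2 * (1 - r) ^- 2 * (s - t) ^+ 2.
Proof.
move=> zr s01 t01; have [/andP[s0 s1] /andP[t0 t1]] := (s01, t01).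
have sz : rnorm (s *r z) <= r.
  by rewrite rnormZ ger0_norm// (le_trans _ zr)// ler_piMl ?rnorm_ge0.
have tz : rnorm (t *r z) <= r.
  by rewrite rnormZ ger0_norm// (le_trans _ zr)// ler_piMl ?rnorm_ge0.
pose w n : A := (t ^+ n) *r z ^+ n.+1.
have wv n : rnorm (w n) <= 1 * r ^+ n.
  rewrite /w rnormZ ger0_norm ?exprn_ge0// ler_pM ?exprn_ge0 ?rnorm_ge0 ?exprn_ile1//.
  rewrite (le_trans (rnormX _ _))// exprS -[leRHS]mul1r ler_pM ?exprn_ge0 ?rnorm_ge0//.
    by rewrite (le_trans zr)// ltW.
  by rewrite lerXn2r ?nnegrE ?rnorm_ge0.
have vm n : series (fun n => 1 * r ^+ n) n <= (1 - r)^-1.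
  by rewrite /series /= -mulr_sumr mul1r series_geometric_le.
have cw := dominated_series_cvg wv vm; set W := limn (series w) in cw.
have rn0 : r ^+ n @[n --> \oo] --> 0 by apply: cvg_expr; rewrite ger0_norm.
have eW : W * (1 - t *r z) = z.
  have h : (fun n => series w n * (1 - t *r z)) @ \oo --> W * (1 - t *r z).
    by apply: cvgM_op cw _; exact: cvg_cst.
  apply: (op_cvg_unique h); apply/cvg_rnormP => e e0.
  move/cvgrPdist_lt: rn0 => /(_ e e0); apply: filterS => n.
  rewrite sub0r normrN ger0_norm ?exprn_ge0// => rne.
  have -> : series w n * (1 - t *r z) = z - w n.
    rewrite /series /=; elim: n {rne} => [|n ih].
      by rewrite big_geq// mul0r /w expr0 scale1r expr1 subrr.
    rewrite big_nat_recr//= mulrDl ih mulrBr mulr1 addrA subrK /w; congr (_ - _).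
    by rewrite op_scaleAr op_scaleAl scalerA -exprSr -rmorphM -exprS.
  by rewrite subKr (le_lt_trans _ rne)// (le_trans (wv n))// mul1r.
pose u n := log_term (s *r z) n - log_term (t *r z) n - (s - t) *r w n.
have uv n : rnorm (u n) <= (s - t) ^+ 2 * (n.+1%:R * r ^+ n).
  pose c := s ^+ n.+1 - t ^+ n.+1 - n.+1%:R * (s - t) * t ^+ n.
  have nz : n.+1%:R != 0 :> R by rewrite pnatr_eq0.
  have -> : u n = (n.+1%:R^-1 * c) *r z ^+ n.+1.
    rewrite /u /log_term /w !op_exprZ !scalerA -!rmorphXn -!rmorphM -!scalerBl -!rmorphB.
    by congr (_%:C *: _); rewrite /c -mulrA [in RHS]mulrBr mulKf// mulrBr.
  rewrite rnormZ normrM [`|n.+1%:R^-1|]ger0_norm ?invr_ge0//.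
  have h1 : n.+1%:R^-1 * `|c| <= n.+1%:R * (s - t) ^+ 2.
    by rewrite ler_pdivrMl ?ltr0n// mulrA -expr2 taylor_power.
  have h2 : rnorm (z ^+ n.+1) <= r ^+ n.
    rewrite (le_trans (rnormX _ _))// exprS -[leRHS]mul1r ler_pM ?exprn_ge0 ?rnorm_ge0//.
      by rewrite (le_trans zr)// ltW.
    by rewrite lerXn2r ?nnegrE ?rnorm_ge0.
  apply: le_trans (ler_pM _ _ h1 h2) _; rewrite ?rnorm_ge0 ?mulr_ge0 ?invr_ge0//.
  by rewrite [leRHS]mulrCA mulrA.
have vm2 n : series (fun n => (s - t) ^+ 2 * (n.+1%:R * r ^+ n)) n
    <= (s - t) ^+ 2 * (1 - r) ^- 2.
  by rewrite /series /= -mulr_sumr ler_wpM2l ?sqr_ge0// series_arith_geometric_le.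
have h : rnorm (mercator (s *r z) - mercator (t *r z) - (s - t) *r W)
    <= (s - t) ^+ 2 * (1 - r) ^- 2.
  apply: (dominated_series_le uv vm2).
  have hs : (fun n => (s - t) *r series w n) @ \oo --> (s - t) *r W.
    by apply: cvgZ => //; exact: cvg_cst.
  have h := cvgB (cvgB (mercator_cvg sz) (mercator_cvg tz)) hs.
  rewrite (_ : series u = (fun n => series (log_term (s *r z)) n -
    series (log_term (t *r z)) n - (s - t) *r series w n)); first exact: h.
  by apply/funext => n; rewrite /series /= scaler_sumr -!sumrB.
have -> : (mercator (s *r z) - mercator (t *r z)) * (1 - t *r z) - (s - t) *r z =
  (mercator (s *r z) - mercator (t *r z) - (s - t) *r W) * (1 - t *r z).
  by rewrite [RHS]mulrBl op_scaleAl eW.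
apply: le_trans (rnormM _ _) _.
have h2 : rnorm (1 - t *r z) <= 2.
  apply: le_trans (rnormB _ _) _; have := @rnorm1_le _ _ A; move: tz sz (r1); lra.
apply: le_trans (ler_pM _ _ h h2) _; rewrite ?rnorm_ge0//.
by rewrite mulrC mulrA mulrAC.
Qed.

(** The path [t |-> e^{mercator (t z)} (1 - t z)] has quadratic increments, so it
    is constant. *)
Lemma expA_mercator z : rnorm z <= r -> expA (mercator z) * (1 - z) = 1.
Proof.
move=> zr; pose F t := expA (mercator (t *r z)) * (1 - t *r z).
have F0 : F 0 = 1 by rewrite /F scale0r mercator0 expA0 mul1r subr0.
have <- : F 1 = expA (mercator z) * (1 - z) by rewrite /F scale1r.
rewrite -F0; set L := (1 - r)^-1.
have L0 : 0 <= L by rewrite invr_ge0 ltW.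
apply: (@quadratic_increments_eq F (expR L * (2 * L ^+ 2 + L + 2 * (L ^+ 2 * expR L)))).
move=> s t s01 t01; have [/andP[s0 s1] /andP[t0 t1]] := (s01, t01).
have bnd k : 0 <= k <= 1 -> rnorm (k *r z) <= r.
  by move=> /andP[k0 k1]; rewrite rnormZ ger0_norm// (le_trans _ zr)// ler_piMl ?rnorm_ge0.
have [sz tz] := (bnd s s01, bnd t t01).
set a := mercator (t *r z); set D := mercator (s *r z) - a.
have aD : GRing.comm a D.
  have c k : GRing.comm (s *r z) (k *r z).
    by rewrite /GRing.comm !op_scaleAl !op_scaleAr !scalerA mulrC.
  have c' k : GRing.comm (t *r z) (k *r z).
    by rewrite /GRing.comm !op_scaleAl !op_scaleAr !scalerA mulrC.
  apply: commrB => //; apply: comm_mercator => //; apply: commr_sym.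
  by apply: comm_mercator.
have [y ey yb] := expA_expand D.
have hN : rnorm (1 - s *r z) <= 2.
  apply: le_trans (rnormB _ _) _; have := @rnorm1_le _ _ A; move: tz sz (r1); lra.
have zh : rnorm ((s - t) *r z) <= `|s - t| by rewrite rnormZ ler_piMr// (le_trans zr)// ltW.
set h := `|s - t| in zh *.
have h0 : 0 <= h by exact: normr_ge0.
have h1 : h <= 1 by rewrite /h ler_norml; lra.
have Dh : rnorm D <= L * h.
  by rewrite (le_trans (mercator_lipschitz sz tz))// ler_wpM2l// -scalerBl -rmorphB.
have D0 := rnorm_ge0 D.
have yh : rnorm y <= L * h * expR L.
  apply: le_trans yb _; rewrite ler_pM ?expR_ge0// ler_expR (le_trans Dh)//.
  by rewrite ler_piMr.
have ah : rnorm a <= L.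
  have := @mercator_lipschitz (t *r z) 0 tz; rewrite rnorm0 mercator0 !subr0 => /(_ r0).
  by move/le_trans; apply; rewrite ler_piMr// (le_trans tz)// ltW.
have -> : F s - F t = expA a * ((D * (1 - t *r z) - (s - t) *r z) -
    D * ((s - t) *r z) + D * y * (1 - s *r z)).
  have -> : F s = expA a * (expA D * (1 - s *r z)).
    by rewrite mulrA -expAD// /D [a + _]addrC subrK.
  rewrite /F -mulrBr ey; congr (_ * _).
  have -> : 1 - s *r z = 1 - t *r z - (s - t) *r z.
    by rewrite rmorphB scalerBl opprB addrA subrK.
  set P := 1 - t *r z; rewrite [(1 + D + D * y) * _]mulrDl addrAC; congr (_ + _).
  rewrite mulrDl mul1r mulrBr [_ - P]addrAC [P - _ - P]addrAC subrr add0r.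
  by rewrite addrC addrAC.
have k1 := mercator_increment zr s01 t01; rewrite -/a -/D in k1.
rewrite -(real_normK (num_real (s - t))) -/h in k1 *.
have k2 : rnorm (D * ((s - t) *r z)) <= L * h * h.
  by apply: le_trans (rnormM _ _) _; rewrite ler_pM ?rnorm_ge0.
have k3 : rnorm (D * y * (1 - s *r z)) <= L * h * (L * h * expR L) * 2.
  by apply: le_trans (rnormM3 _ _ _) _; rewrite !ler_pM ?mulr_ge0 ?rnorm_ge0.
apply: le_trans (rnormM _ _) _.
have k4 : rnorm (expA a) <= expR L by rewrite (le_trans (rnorm_expA _))// ler_expR.
rewrite -[leRHS]mulrA ler_pM ?rnorm_ge0//.
have := rnormD (D * (1 - t *r z) - (s - t) *r z - D * ((s - t) *r z)) (D * y * (1 - s *r z)).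
have := rnormB (D * (1 - t *r z) - (s - t) *r z) (D * ((s - t) *r z)).
rewrite -exprVn -/L in k1; lra.
Qed.

End Logarithm.

(** * Positive invertible elements and their logarithms *)

Section PositiveElements.
Context {R : realType} {V : hilbertType R} {A : vonNeumannType V}.
Implicit Types (x y z : A) (s t : R) (u v : V).

(** For self-adjoint elements this is positivity together with invertibility. *)
Definition coercive x :=
  exists2 e : R, 0 < e & forall u, e * rnorm u ^+ 2 <= rdot (rep x u) u.

Lemma rdotNl u v : rdot (- u) v = - rdot u v.
Proof. by rewrite -[u]scale1r -scaleNr -(rmorphN1 (real_complex R)) rdotZl mulN1r scale1r. Qed.

Lemma coercive_star_mul x y : y * x = 1 -> coercive (star x * x).
Proof.
move=> yx; pose m := rnorm y + 1.
have m0 : 0 < m by rewrite ltr_wpDl ?rnorm_ge0.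
exists (m ^- 2) => [|u]; first by rewrite invr_gt0 exprn_gt0.
rewrite repM rdot_rep starK rdot_sqr mulrC ler_pdivrMr ?exprn_gt0// -exprMn.
rewrite lerXn2r ?nnegrE ?mulr_ge0 ?rnorm_ge0 ?(ltW m0)//.
have eu : rep y (rep x u) = u by rewrite -repM -[op_mul y x]/(y * x) yx rep1.
rewrite -{1}eu (le_trans (rep_rnorm_le _ _))// mulrC.
by rewrite ler_wpM2l ?rnorm_ge0// lerDl.
Qed.

Lemma selfadj1 : selfadj (1 : A).
Proof. exact: star1. Qed.

Lemma selfadjD x y : selfadj x -> selfadj y -> selfadj (x + y).
Proof. by rewrite /selfadj /= starD => -> ->. Qed.

Lemma selfadjN x : selfadj x -> selfadj (- x).
Proof. by rewrite /selfadj /= starN => ->. Qed.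

Lemma selfadjB x y : selfadj x -> selfadj y -> selfadj (x - y).
Proof. by move=> hx hy; apply: selfadjD => //; exact: selfadjN. Qed.

Lemma selfadjZ t x : selfadj x -> selfadj (t *r x).
Proof. by rewrite /selfadj /= starZr => ->. Qed.

Lemma selfadj_expA x : selfadj x -> selfadj (expA x).
Proof. by rewrite /selfadj /= star_expA => ->. Qed.

Lemma selfadj_star_mul x y : selfadj y -> selfadj (x * y * star x).
Proof. by rewrite /selfadj /= !starM starK mulrA => ->. Qed.

Lemma half_D x : 2^-1 *r x + 2^-1 *r x = x.
Proof.
have h : 2^-1 + 2^-1 = 1 :> R by lra.
by rewrite -scalerDl -rmorphD h scale1r.
Qed.

Lemma comm_scale s t x : GRing.comm (s *r x) (t *r x).
Proof. by rewrite /GRing.comm !op_scaleAl !op_scaleAr !scalerA mulrC. Qed.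

Lemma expA_scaleD s t x : expA ((s + t) *r x) = expA (s *r x) * expA (t *r x).
Proof. by rewrite rmorphD scalerDl expAD//; exact: comm_scale. Qed.

Lemma expA_scale_eq s t (r : R) x : s + t = r ->
  expA (s *r x) * expA (t *r x) = expA (r *r x).
Proof. by move=> <-; rewrite expA_scaleD. Qed.

Lemma expA_half x : expA x = expA (2^-1 *r x) * expA (2^-1 *r x).
Proof. by rewrite -expAD ?half_D//; exact: comm_scale. Qed.

Lemma coercive_expA x : selfadj x -> coercive (expA x).
Proof.
move=> hx; rewrite expA_half -{1}(selfadj_expA (selfadjZ 2^-1 hx)).
exact: coercive_star_mul (expA_Nmul _).
Qed.

(** For a self-adjoint [z] the norm is the numerical radius; this is the
    Cauchy-Schwarz inequality for the form [<z u, v>]. *)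
Lemma rnorm_le_form z (r : R) : selfadj z -> 0 <= r ->
  (forall u, 0 <= rdot (rep z u) u <= r * rnorm u ^+ 2) -> rnorm z <= r.
Proof.
move=> hz r0 h; apply: rnorm_min => // u.
have gC a b : rdot (rep z a) b = rdot (rep z b) a.
  by rewrite rdot_rep (hz : star z = z) rdotC.
have gD a b c : rdot (rep z (a + b)) c = rdot (rep z a) c + rdot (rep z b) c.
  by rewrite linearD rdotDl.
have gZ t a b : rdot (rep z (t *r a)) b = t * rdot (rep z a) b.
  by rewrite linearZ rdotZl.
have g0 a : 0 <= rdot (rep z a) a by case/andP: (h a).
have := real_form_CS gC gD gZ g0 u (rep z u); rewrite rdot_sqr.
set p := rnorm (rep z u); have p0 : 0 <= p by exact: rnorm_ge0.
have [h1 h2] := (h u, h (rep z u)); rewrite -/p in h2.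
set q := rnorm u in h1 *; have q0 : 0 <= q by exact: rnorm_ge0.
move=> h3; have h4 : (p ^+ 2) ^+ 2 <= (r * q * p) ^+ 2.
  apply: le_trans h3 _; case/andP: h1 => h10 h11; case/andP: h2 => h20 h21.
  apply: le_trans (ler_pM h10 h20 h11 h21) _.
  by rewrite !exprMn expr2; set P := p ^+ 2; set Q := q ^+ 2; lra.
have [->|pn0] := eqVneq p 0; first by rewrite mulr_ge0.
have pp : 0 < p by rewrite lt_def pn0.
rewrite -(ler_pM2r pp) -expr2.
by rewrite ler_pXn2r// nnegrE ?exprn_ge0// mulr_ge0// mulr_ge0 in h4.
Qed.

(** Any [c] above the norm of [x] will do: with the constant [e] of coercivity,
    [1 - c^{-1} x] lies between [0] and [1 - e / c]. *)
Lemma coercive_scaled x : selfadj x -> coercive x ->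
  exists c r : R, [/\ 0 < c, 0 <= r < 1 & rnorm (1 - c^-1 *r x) <= r].
Proof.
move=> hx [e e0 he]; pose c := rnorm x + e.
have c0 : 0 < c by rewrite ltr_wpDl ?rnorm_ge0.
have x0 := rnorm_ge0 x.
exists c, (1 - e / c); split=> //.
  by rewrite subr_ge0 ler_pdivrMr// mul1r lerDr x0 ltrBlDr ltrDl divr_gt0.
have ec : 0 <= 1 - e / c by rewrite subr_ge0 ler_pdivrMr// mul1r lerDr.
apply: rnorm_le_form => // [|u].
  by apply: selfadjB; [exact: selfadj1|exact: selfadjZ].
have -> : rdot (rep (1 - c^-1 *r x) u) u = rnorm u ^+ 2 - c^-1 * rdot (rep x u) u.
  rewrite repD rep1 rdotDl rdot_sqr; congr (_ + _).
  by rewrite -scaleNr -rmorphN repZ rdotZl mulNr.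
have h1 := he u; have h2 : rdot (rep x u) u <= c * rnorm u ^+ 2.
  apply: le_trans (rdot_le _ _) _; rewrite expr2 mulrA ler_wpM2r ?rnorm_ge0//.
  by apply: le_trans (rep_rnorm_le _ _) _; rewrite ler_wpM2r ?rnorm_ge0// lerDl ltW.
apply/andP; split; first by rewrite subr_ge0 ler_pdivrMl.
by rewrite mulrBl mul1r lerD2l lerN2 -mulrA [X in X <= _]mulrCA ler_pM2l ?invr_gt0.
Qed.

Lemma expA_log_scaled (c r : R) x : 0 < c -> 0 <= r < 1 -> rnorm (1 - c^-1 *r x) <= r ->
  expA (ln c *r (1 : A) - mercator (1 - c^-1 *r x)) = x.
Proof.
move=> c0 r01 zr; set z := 1 - c^-1 *r x.
have cm : GRing.comm (ln c *r (1 : A)) (- mercator z).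
  by apply: commrN; rewrite /GRing.comm op_scaleAl op_scaleAr mul1r mulr1.
rewrite expAD// expA_scalar lnK ?posrE//.
have -> : expA (- mercator z) = 1 - z.
  by rewrite -[LHS]mulr1 -[X in _ * X](expA_mercator r01 zr) mulrA expA_Nmul mul1r.
rewrite subKr op_scaleAl mul1r scalerA -rmorphM mulfV ?gt_eqF// scale1r//.
Qed.

(** [e^{z/2}] is a positive square root of [1], so it is [1] as well.  Iterating,
    arbitrarily small multiples of [z] have exponential [1], and near [0] the
    exponential is injective. *)
Lemma expA_eq1 z : selfadj z -> expA z = 1 -> z = 0.
Proof.
have half y : selfadj y -> expA y = 1 -> expA (2^-1 *r y) = 1.
  move=> hy e1; set w := expA (2^-1 *r y); have ww : w * w = 1 by rewrite -expA_half.
  apply: op_ext => u; rewrite rep1; apply/subr0_eq/rnorm_eq0.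
  set v := rep w u - u; have v0 : rep w v = - v.
    by rewrite /v linearB /= -repM -[op_mul w w]/(w * w) ww rep1 opprB.
  have [e e0 he] := coercive_expA (selfadjZ 2^-1 hy).
  have := he v; rewrite -/w v0 rdotNl rdot_sqr => h.
  have : 0 <= rnorm v ^+ 2 by rewrite sqr_ge0.
  have h1 : (e + 1) * rnorm v ^+ 2 <= 0 by rewrite mulrDl mul1r -lerBrDr sub0r.
  rewrite pmulr_rle0 ?addr_gt0// in h1 => h2.
  have : rnorm v ^+ 2 = 0 by apply: le_anti; rewrite h1.
  by move=> /eqP; rewrite expf_eq0 => /eqP.
move=> hz e1; have iterhalf n : expA ((2^-1 ^+ n) *r z) = 1.
  elim: n => [|n ih]; first by rewrite expr0 scale1r.
  by rewrite exprS rmorphM -scalerA half//; exact: selfadjZ.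
have cv : (2^-1 : R) ^+ n @[n --> \oo] --> 0.
  by apply: cvg_expr; rewrite ger0_norm// invf_lt1// ltr1n.
have z0 := rnorm_ge0 z.
pose d := (rnorm z * expR (rnorm z) + 1)^-1.
have d0 : 0 < d by rewrite invr_gt0 ltr_wpDl// mulr_ge0// expR_ge0.
move/cvgrPdist_lt: cv => /(_ d d0) [n _ /(_ n (leqnn n))].
rewrite sub0r normrN ger0_norm ?exprn_ge0 ?invr_ge0//.
set h := 2^-1 ^+ n => hd; have h0 : 0 < h by rewrite exprn_gt0// invr_gt0.
have h1 : h <= 1 by rewrite exprn_ile1 ?invr_ge0// invf_le1// ler1n.
have [y ey yb] := expA_expand (h *r z).
have e0 : h *r z * (1 + y) = 0.
  by apply: (addrI 1); rewrite addr0 mulrDr mulr1 addrA -ey iterhalf.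
suff : h *r z = 0.
  by move=> /(congr1 rnorm); rewrite rnormZ rnorm0 gtr0_norm// => /eqP;
    rewrite mulf_eq0 gt_eqF//= => /eqP/rnorm_eq0.
apply: rnorm_eq0; apply/eqP; rewrite eq_le rnorm_ge0 andbT; set w := h *r z in e0 yb *.
have wz : rnorm w = h * rnorm z by rewrite rnormZ gtr0_norm.
have yb1 : rnorm y < 1.
  apply: le_lt_trans yb _; rewrite wz.
  apply: (@le_lt_trans _ _ (h * (rnorm z * expR (rnorm z)))).
    by rewrite mulrA ler_wpM2l ?mulr_ge0 ?(ltW h0)// ler_expR ler_piMl.
  have m0 : 0 <= rnorm z * expR (rnorm z) by rewrite mulr_ge0// expR_ge0.
  move: hd; rewrite /d; set m := rnorm z * _ in m0 *.
  rewrite -[X in _ < X]mul1r ltr_pdivlMr ?ltr_wpDl//; nra.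
have : rnorm w <= rnorm w * rnorm y.
  rewrite -{1}[w]mulr1 -[X in w * X](addrK y) mulrBr e0 sub0r rnormN.
  exact: rnormM.
have := rnorm_ge0 w; have := rnorm_ge0 y; nra.
Qed.

(** In the scaled form [c (1 - z)] of [x] the Mercator series converges. *)
Lemma coercive_log x : selfadj x -> coercive x ->
  exists l, [/\ selfadj l, expA l = x & forall y, GRing.comm y x -> GRing.comm y l].
Proof.
move=> hx cx; have [c [r [c0 r01 zr]]] := coercive_scaled hx cx.
exists (ln c *r (1 : A) - mercator (1 - c^-1 *r x)); split.
- apply: selfadjB; first by apply: selfadjZ; exact: selfadj1.
  rewrite /selfadj /= (star_mercator r01 zr) starB star1 starZr.
  by rewrite (hx : star x = x).
- exact: expA_log_scaled zr.
- move=> y yx; apply: commrB; first by rewrite /GRing.comm op_scaleAl op_scaleAr mulr1 mul1r.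
  apply: (comm_mercator r01 zr); apply: commrB; first exact: commr1.
  by rewrite /GRing.comm op_scaleAl op_scaleAr yx.
Qed.

(** Two logarithms of [p] both commute with the one given by the power series;
    their difference with it has exponential [1]. *)
Lemma expA_inj x y : selfadj x -> selfadj y -> expA x = expA y -> x = y.
Proof.
move=> hx hy e; have [l [hl el cl]] := coercive_log (selfadj_expA hx) (coercive_expA hx).
have eql w : selfadj w -> expA w = expA x -> w = l.
  move=> hw ew; apply/subr0_eq/expA_eq1; first exact: selfadjB.
  have wl : GRing.comm w l by apply: cl; rewrite -ew; exact: comm_expA.
  rewrite expAD; last exact: commrN.
  by rewrite ew -el expA_mulN.
by rewrite (eql y)// (eql x).
Qed.

Lemma logA_expA x : selfadj x -> logA (expA x) = x.
Proof.
move=> hx; rewrite /logA; case: xgetP => [y -> [hy ey]|/(_ x)]; last by case.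
exact: expA_inj.
Qed.

Lemma powA_expA x t : selfadj x -> powA (expA x) t = expA (t *r x).
Proof. by move=> hx; rewrite /powA logA_expA. Qed.

Lemma invA_unique x y : x * y = 1 -> y * x = 1 -> invA x = y.
Proof.
move=> xy yx; rewrite /invA; case: xgetP => [z _ [h1 h2]|/(_ y)]; last by case.
by rewrite -[z]mulr1 -xy mulrA [z * _]h1 mul1r.
Qed.

Lemma invA_expA x : invA (expA x) = expA (- x).
Proof. by apply: invA_unique; [exact: expA_mulN|exact: expA_Nmul]. Qed.

(** Near a given exponential, the logarithm is given by one and the same
    Mercator series, hence is Lipschitz. *)
Lemma log_lipschitz_at x : selfadj x -> exists K d : R, [/\ 0 <= K, 0 < d &
  forall y, selfadj y -> rnorm (expA y - expA x) < d ->
    rnorm (y - x) <= K * rnorm (expA y - expA x)].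
Proof.
move=> hx; have [c [r [c0 /andP[r0 r1] zr]]] :=
  coercive_scaled (selfadj_expA hx) (coercive_expA hx).
pose r' := (1 + r) / 2; have r01' : 0 <= r' < 1 by rewrite /r'; lra.
have zr' : rnorm (1 - c^-1 *r expA x) <= r' by apply: le_trans zr _; rewrite /r'; lra.
have q0 : 0 <= (1 - r')^-1 by rewrite invr_ge0; lra.
exists ((1 - r')^-1 * c^-1), (c * (1 - r) / 2); split=> [||y hy hd].
- by rewrite mulr_ge0// invr_ge0 ltW.
- by rewrite divr_gt0// mulr_gt0// subr_gt0.
have e1 : 1 - c^-1 *r expA y - (1 - c^-1 *r expA x) = (- c^-1) *r (expA y - expA x).
  by rewrite opprB addrC -addrA addKr -scalerBr rmorphN scaleNr -scalerN opprB.
have dy : rnorm (1 - c^-1 *r expA y - (1 - c^-1 *r expA x)) = c^-1 * rnorm (expA y - expA x).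
  by rewrite e1 rnormZ normrN ger0_norm// invr_ge0 ltW.
have yr' : rnorm (1 - c^-1 *r expA y) <= r'.
  rewrite -[1 - _](subrK (1 - c^-1 *r expA x)) (le_trans (rnormD _ _))// dy.
  have : c^-1 * rnorm (expA y - expA x) <= (1 - r) / 2.
    by rewrite ler_pdivrMl// (le_trans (ltW hd))// mulrA.
  by rewrite /r'; lra.
have lg w : selfadj w -> rnorm (1 - c^-1 *r expA w) <= r' ->
    w = ln c *r (1 : A) - mercator (1 - c^-1 *r expA w).
  move=> hw wr; apply: expA_inj => //; last by rewrite (expA_log_scaled c0 r01' wr).
  apply: selfadjB; first by apply: selfadjZ; exact: selfadj1.
  rewrite /selfadj /= (star_mercator r01' wr) starB star1 starZr.
  by rewrite (selfadj_expA hw : star _ = _).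
have e2 : y - x = mercator (1 - c^-1 *r expA x) - mercator (1 - c^-1 *r expA y).
  have := lg y hy yr'; have := lg x hx zr'.
  set X := mercator _; set Y := mercator _; set L := ln c *r (1 : A) => ex ey.
  transitivity (L - Y - (L - X)); first by rewrite -ex -ey.
  by rewrite opprB addrC addrA subrK.
rewrite e2 -mulrA -dy rnormBC.
by have := mercator_lipschitz r01' yr' zr'.
Qed.

End PositiveElements.

(** * The inner product of the trace *)

Section TraceForm.
Context {R : realType} {V : hilbertType R} {A : vonNeumannType V}.
Variable tau : {scalar A}.
Hypothesis tauP : tracial_state tau.
Implicit Types (x y z c d : A) (s t : R).

Definition retr x : R := complex.Re (tau x).

Lemma retrD x y : retr (x + y) = retr x + retr y.
Proof. by rewrite /retr linearD raddfD. Qed.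

Lemma retrZ t x : retr (t *r x) = t * retr x.
Proof. by rewrite /retr linearZ /= ReZ. Qed.

Lemma retrN x : retr (- x) = - retr x.
Proof. by rewrite /retr linearN raddfN. Qed.

Lemma retrB x y : retr (x - y) = retr x - retr y.
Proof. by rewrite retrD retrN. Qed.

Lemma retrC x y : retr (x * y) = retr (y * x).
Proof. by rewrite /retr; congr complex.Re; exact: (state_tracial tauP). Qed.

Definition tdot x y := retr (star y * x).

Lemma tdot_ge0 x : 0 <= tdot x x.
Proof. by have := state_ge0 tauP x; rewrite lecE => /andP[_]. Qed.

Lemma tdotC x y : tdot x y = tdot y x.
Proof.
have h z : complex.Im (tau (star z * z)) = 0.
  by have := state_ge0 tauP z; rewrite lecE => /andP[/eqP].
have := h (x + 'i%C *: y).
rewrite starD starZ mulrDl !mulrDr !op_scaleAl !op_scaleAr !linearD !linearZ /=.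
have := h x; have := h y; rewrite /tdot /retr.
case: (tau (star x * x)) => a1 b1; case: (tau (star y * y)) => a2 b2.
case: (tau (star x * y)) => a3 b3; case: (tau (star y * x)) => a4 b4 /=.
by lra.
Qed.

Lemma tdotDl x y z : tdot (x + y) z = tdot x z + tdot y z.
Proof. by rewrite /tdot mulrDr retrD. Qed.

Lemma tdotZl t x y : tdot (t *r x) y = t * tdot x y.
Proof. by rewrite /tdot op_scaleAr retrZ. Qed.

Lemma tdotNl x y : tdot (- x) y = - tdot x y.
Proof. by rewrite /tdot mulrN retrN. Qed.

Lemma tdotBl x y z : tdot (x - y) z = tdot x z - tdot y z.
Proof. by rewrite tdotDl tdotNl. Qed.

Lemma tdotDr x y z : tdot z (x + y) = tdot z x + tdot z y.
Proof. by rewrite tdotC tdotDl -!(tdotC z). Qed.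

Lemma tdotZr t x y : tdot x (t *r y) = t * tdot x y.
Proof. by rewrite tdotC tdotZl tdotC. Qed.

Lemma tdotBr x y z : tdot z (x - y) = tdot z x - tdot z y.
Proof. by rewrite tdotC tdotBl -!(tdotC z). Qed.

Lemma tdot_mull x y z : tdot (x * y) z = tdot y (star x * z).
Proof. by rewrite /tdot starM starK mulrA. Qed.

Lemma tdot_mulr x y z : tdot (y * x) z = tdot y (z * star x).
Proof. by rewrite /tdot starM starK mulrA retrC mulrA. Qed.

Lemma tdot_star x y : tdot (star x) (star y) = tdot x y.
Proof. by rewrite [RHS]tdotC /tdot starK retrC. Qed.

Definition tnorm x : R := Num.sqrt (tdot x x).

Lemma tnorm_ge0 x : 0 <= tnorm x.
Proof. exact: sqrtr_ge0. Qed.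

Lemma tnorm_sqr x : tnorm x ^+ 2 = tdot x x.
Proof. by rewrite sqr_sqrtr ?tdot_ge0. Qed.

Lemma tdot_le x y : tdot x y <= tnorm x * tnorm y.
Proof. exact: (real_form_CS_sqrt tdotC tdotDl tdotZl tdot_ge0). Qed.

Lemma tnormZ t x : tnorm (t *r x) = `|t| * tnorm x.
Proof. by rewrite /tnorm tdotZl tdotZr mulrA -expr2 sqrtrM ?sqr_ge0// sqrtr_sqr. Qed.

Lemma tnormN x : tnorm (- x) = tnorm x.
Proof. by rewrite /tnorm tdotNl tdotC tdotNl opprK. Qed.

Lemma tnormD x y : tnorm (x + y) <= tnorm x + tnorm y.
Proof.
rewrite -(@ler_pXn2r _ 2) ?nnegrE ?addr_ge0 ?tnorm_ge0//.
rewrite tnorm_sqr tdotDl !tdotDr (tdotC y x) sqrrD !tnorm_sqr.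
by have := tdot_le x y; lra.
Qed.

Lemma tnorm_dist x y : `|tnorm x - tnorm y| <= tnorm (x - y).
Proof.
have h a b : tnorm a - tnorm b <= tnorm (a - b).
  by rewrite lerBlDr; have := tnormD (a - b) b; rewrite subrK.
by rewrite ler_norml lerNl opprB h andbT -[tnorm (x - y)]tnormN opprB h.
Qed.

Lemma tnorm_star x : tnorm (star x) = tnorm x.
Proof. by rewrite /tnorm tdot_star. Qed.

Lemma tnorm_1 : tnorm 1 = 1.
Proof. by rewrite /tnorm /tdot star1 mulr1 /retr (state1 tauP) sqrtr1. Qed.

(** For a scalar [c] above [rnorm x ^+ 2] the element [c - star x * x] is coercive,
    so it is the square of a self-adjoint element and its trace form is nonnegative. *)
Lemma tnorm_mull x y : tnorm (x * y) <= rnorm x * tnorm y.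
Proof.
rewrite -(@ler_pXn2r _ 2) ?nnegrE ?mulr_ge0 ?rnorm_ge0 ?tnorm_ge0// exprMn !tnorm_sqr.
have key e : 0 < e -> tdot (x * y) (x * y) <= (rnorm x ^+ 2 + e) * tdot y y.
  move=> e0; set c := _ + e; pose p := c *r (1 : A) - star x * x.
  have hp : selfadj p.
    apply: selfadjB; first by apply: selfadjZ; exact: selfadj1.
    by rewrite /selfadj /= starM starK.
  have cp : coercive p.
    exists e => // u; rewrite /p repD repZ rep1 rdotDl rdotZl rdot_sqr.
    rewrite -scaleN1r repZ -(rmorphN1 (real_complex R)) rdotZl repM rdot_rep starK.
    rewrite rdot_sqr.
    have := rep_rnorm_le x u; rewrite -(@ler_pXn2r _ 2) ?nnegrE ?mulr_ge0 ?rnorm_ge0//.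
    by rewrite exprMn /c; lra.
  have [l [hl el _]] := coercive_log hp cp.
  have : 0 <= tdot (p * y) y.
    rewrite -el expA_half -mulrA tdot_mull.
    by rewrite (selfadj_expA (selfadjZ 2^-1 hl) : star _ = _) tdot_ge0.
  rewrite /p mulrBl op_scaleAl mul1r tdotBl tdotZl.
  by rewrite -mulrA [tdot (star x * _) _]tdot_mull starK subr_ge0.
apply/ler_addgt0Pr => e e0; have q := tdot_ge0 y.
have d0 : 0 < e / (tdot y y + 1) by rewrite divr_gt0// ltr_wpDl.
apply: le_trans (key _ d0) _; rewrite mulrDl lerD2l mulrAC ler_pdivrMr ?ltr_wpDl//.
by rewrite ler_wpM2l ?(ltW e0)// lerDl.
Qed.

Lemma tnorm_mulr x y : tnorm (y * x) <= tnorm y * rnorm x.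
Proof. by rewrite -tnorm_star starM mulrC -rnorm_star -(tnorm_star y) tnorm_mull. Qed.

Lemma tnorm_rnorm x : tnorm x <= rnorm x.
Proof. by have := tnorm_mull x 1; rewrite tnorm_1 !mulr1. Qed.

Lemma tnorm_mul3 x y z : tnorm (x * y * z) <= rnorm x * tnorm y * rnorm z.
Proof.
by rewrite (le_trans (tnorm_mulr _ _))// ler_wpM2r ?rnorm_ge0// tnorm_mull.
Qed.

(** With [y = e^{c/2} d e^{-c/2}], whose adjoint is [e^{-c/2} d e^{c/2}], the
    left-hand side is the trace of [y y] and the right-hand side that of
    [star y * y]: this is the Cauchy-Schwarz inequality for [y] and [star y]. *)
Lemma conj_trace_ge c d : selfadj c -> selfadj d ->
  tnorm d ^+ 2 <= retr (d * expA c * d * expA (- c)).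
Proof.
move=> hc hd; set p := expA (2^-1 *r c); set q := expA (- (2^-1 *r c)).
have sp : star p = p by rewrite (selfadj_expA (selfadjZ 2^-1 hc) : star _ = _).
have sq : star q = q by rewrite (selfadj_expA (selfadjN (selfadjZ 2^-1 hc)) : star _ = _).
have pq : p * q = 1 by exact: expA_mulN.
have qp : q * p = 1 by exact: expA_Nmul.
have -> : expA c = p * p by rewrite -expA_half.
have -> : expA (- c) = q * q by rewrite -expAD ?half_D -?opprD ?half_D.
set y := p * d * q; have ys : star y = q * d * p.
  by rewrite /y !starM sp sq (hd : star d = d) mulrA.
have -> : retr (d * (p * p) * d * (q * q)) = tdot y y.
  by rewrite /tdot ys /y retrC !mulrA -[RHS]retrC !mulrA retrC !mulrA.
have -> : tnorm d ^+ 2 = tdot y (star y).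
  rewrite tnorm_sqr /tdot starK (hd : star d = d) /y.
  have -> : p * d * q * (p * d * q) = p * d * (q * p) * d * q by rewrite !mulrA.
  by rewrite qp mulr1 retrC !mulrA qp mul1r.
rewrite (le_trans (tdot_le _ _))// tnorm_star -expr2 tnorm_sqr//.
Qed.

End TraceForm.

(** * The differential of the exponential *)

Section MetricIncreasing.
Context {R : realType} {V : hilbertType R} {A : vonNeumannType V}.
Variable tau : {scalar A}.
Hypothesis tauP : tracial_state tau.
Implicit Types (x y z a b c d g k u : A) (s t : R).
Local Notation retr := (retr tau).
Local Notation tdot := (tdot tau).
Local Notation tnorm := (tnorm tau).

Lemma retr_le d x : selfadj d -> retr (d * x) <= tnorm d * tnorm x.
Proof.
by move=> hd; rewrite mulrC -{1}(hd : star d = d); exact: (tdot_le tauP).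
Qed.

Lemma rnorm_expA_le m x : rnorm x <= m -> rnorm (expA x) <= expR m.
Proof. by move=> h; rewrite (le_trans (rnorm_expA _))// ler_expR. Qed.

Lemma rnormZ_le t m x : `|t| <= 1 -> rnorm x <= m -> rnorm (t *r x) <= m.
Proof.
by move=> t1 xm; rewrite rnormZ (le_trans _ xm)// ler_piMl ?rnorm_ge0.
Qed.

Lemma expA_increment_rem (m h : R) c c' : 0 <= h <= 1 -> rnorm c <= m -> rnorm c' <= m ->
  exists2 e, expA (h *r c') - expA (h *r c) = h *r (c' - c) + e &
    rnorm e <= 2 * m ^+ 2 * expR m * h ^+ 2.
Proof.
move=> /andP[h0 h1] cm cm'; have m0 : 0 <= m by apply: le_trans cm; exact: rnorm_ge0.
have rem x : rnorm x <= m -> exists2 e, expA (h *r x) = 1 + h *r x + e &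
    rnorm e <= m ^+ 2 * expR m * h ^+ 2.
  move=> xm; have [y ey yb] := expA_expand (h *r x); exists (h *r x * y) => //.
  have hx : rnorm (h *r x) <= h * m by rewrite rnormZ ger0_norm// ler_wpM2l.
  have hx' : rnorm (h *r x) <= m by apply: rnormZ_le => //; rewrite ger0_norm.
  apply: le_trans (rnormM _ _) _.
  have h3 : rnorm y <= h * m * expR m.
    by apply: le_trans yb _; rewrite ler_pM ?rnorm_ge0 ?expR_ge0// ler_expR.
  apply: le_trans (ler_pM _ _ hx h3) _; rewrite ?rnorm_ge0//.
  by set E := expR m; lra.
have [e he eb] := rem c cm; have [e' he' eb'] := rem c' cm'.
exists (e' - e); last by rewrite (le_trans (rnormB _ _))//; lra.
rewrite he he' scalerBr opprD addrACA; congr (_ + _).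
by rewrite opprD addrACA subrr add0r.
Qed.

(** The derivative of [s |-> e^{(1-s) c} e^{s c'}] is
    [e^{(1-s) c} (c' - c) e^{s c'}], whose second exponential differs from
    [e^{s c}] by at most a multiple of [rnorm (c' - c)]; with [e^{s c}] in its place
    the trace is bounded below by [conj_trace_ge]. *)
Lemma expA_increment_ge (m : R) c c' : selfadj c -> selfadj c' ->
  rnorm c <= m -> rnorm c' <= m ->
  tnorm (c' - c) ^+ 2 * (1 - expR m ^+ 3 * rnorm (c' - c)) <=
  retr ((c' - c) * (expA (- (2^-1 *r c)) * (expA c' - expA c) * expA (- (2^-1 *r c)))).
Proof.
move=> hc hc' cm cm'; set d := c' - c; set q := expA (- _); set E := expR m.
set nd := tnorm d; set Nd := rnorm d.
have m0 : 0 <= m by apply: le_trans cm; exact: rnorm_ge0.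
have E0 : 0 <= E by exact: expR_ge0.
have hd : selfadj d by exact: selfadjB.
have nd0 : 0 <= nd by exact: tnorm_ge0.
have Nd0 : 0 <= Nd by exact: rnorm_ge0.
pose F s := expA ((1 - s) *r c) * expA (s *r c').
pose G s := - retr (d * (q * F s * q)).
pose C := nd ^+ 2 * E ^+ 3 * m + 2 * nd * E ^+ 4 * m ^+ 2.
suff : G 1 <= G 0 + - (nd ^+ 2 * (1 - E ^+ 3 * Nd)).
  rewrite /G /F subrr subr0 !scale0r !scale1r expA0 mul1r mulr1.
  have -> : q * (expA c' - expA c) * q = q * expA c' * q - q * expA c * q.
    by rewrite mulrBr mulrBl.
  by rewrite [d * (_ - _)]mulrBr retrB; lra.
apply: (@quadratic_le_linear _ G _ C) => s t t0 st s1.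
set h := s - t; have h01 : 0 <= h <= 1 by rewrite /h; lra.
have [h0 h1] := andP h01.
have [e he eb] := expA_increment_rem h01 cm cm'; rewrite -/d -/E in he eb.
set P := q * expA ((1 - s) *r c).
have eP : P = expA ((2^-1 - s) *r c).
  by rewrite /P /q -rscaleN; apply: expA_scale_eq; lra.
set Q := expA (s *r c) * q.
have eQ : Q = expA (- ((2^-1 - s) *r c)).
  by rewrite /Q /q -!rscaleN; apply: expA_scale_eq; lra.
set Z := expA (t *r c') - expA (s *r c).
have ZN : rnorm Z <= E * Nd + E * m * h.
  rewrite /Z -[_ - _](subrKA (expA (t *r c))) (le_trans (rnormD _ _))// lerD//.
    have tc x : rnorm x <= m -> rnorm (t *r x) <= m.
      by apply: rnormZ_le; rewrite ger0_norm// (le_trans st).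
    apply: le_trans (expA_lipschitz (tc _ cm') (tc _ cm)) _.
    rewrite ler_wpM2l// -scalerBr rnormZ ger0_norm// ler_piMl ?rnorm_ge0//.
    by rewrite (le_trans st).
  have tc w : 0 <= w <= 1 -> rnorm (w *r c) <= m.
    by move=> /andP[w0 w1]; apply: rnormZ_le => //; rewrite ger0_norm.
  have ht := tc t; have hs := tc s.
  apply: le_trans (@expA_lipschitz _ _ _ m _ _ _ _) _; [apply: ht; lra|apply: hs; lra|].
  rewrite -mulrA ler_wpM2l// -rscaleB rnormZ distrC ger0_norm//.
  by rewrite mulrC ler_wpM2r.
have PN : rnorm P <= E.
  by rewrite eP rnorm_expA_le// rnormZ_le// ler_norml; lra.
have qN : rnorm q <= E.
  by rewrite /q -rscaleN rnorm_expA_le// rnormZ_le// normrN ger0_norm//; lra.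
have tN : rnorm (expA (t *r c')) <= E.
  by rewrite rnorm_expA_le// rnormZ_le// ger0_norm// (le_trans st).
have -> : G s - G t = - (h * retr (d * P * d * Q)) + h * retr (d * - (P * d * (Z * q)))
    + retr (d * - (P * e * (expA (t *r c') * q))).
  have eF : F s - F t = expA ((1 - s) *r c) * (h *r d + e) * expA (t *r c').
    have e1 : expA (s *r c') = expA (h *r c') * expA (t *r c').
      by apply/esym/expA_scale_eq; rewrite /h; lra.
    have e2 : expA ((1 - t) *r c) = expA ((1 - s) *r c) * expA (h *r c).
      by apply/esym/expA_scale_eq; rewrite /h; lra.
    by rewrite -he /F e1 e2 mulrBr mulrBl !mulrA.
  have -> : G s - G t = - retr (d * (q * (F s - F t) * q)).
    have -> : q * (F s - F t) * q = q * F s * q - q * F t * q by rewrite mulrBr mulrBl.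
    by rewrite /G [d * (_ - _)]mulrBr retrB; lra.
  have et : expA (t *r c') = expA (s *r c) + Z by rewrite /Z addrC subrK.
  have -> : q * (F s - F t) * q = h *r (P * d * Q) + h *r (P * d * (Z * q))
      + P * e * (expA (t *r c') * q).
    rewrite eF mulrDr mulrDl mulrDr mulrDl; congr (_ + _); last by rewrite /P !mulrA.
    rewrite -scalerDr -mulrDr /Q -mulrDl -et /P.
    by rewrite op_scaleAr !op_scaleAl op_scaleAr op_scaleAl !mulrA.
  have lin x1 x2 x3 : retr (d * (h *r x1 + h *r x2 + x3)) =
      h * retr (d * x1) + h * retr (d * x2) + retr (d * x3).
    by rewrite 2!mulrDr 2!retrD !op_scaleAr !retrZ.
  rewrite lin [d * (P * d * Q)]mulrA [d * (P * d)]mulrA.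
  by rewrite [d * - (P * d * _)]mulrN [d * - (P * e * _)]mulrN !retrN; lra.
have k1 : nd ^+ 2 <= retr (d * P * d * Q).
  by rewrite eP eQ; apply: (conj_trace_ge tauP) => //; exact: selfadjZ.
have k2 : retr (d * - (P * d * (Z * q))) <= nd * (E * nd * ((E * Nd + E * m * h) * E)).
  apply: le_trans (retr_le _ hd) _; rewrite tnormN// ler_wpM2l//.
  apply: le_trans (tnorm_mul3 tauP _ _ _) _.
  rewrite !ler_pM ?rnorm_ge0 ?mulr_ge0 ?rnorm_ge0 ?tnorm_ge0//.
  by rewrite (le_trans (rnormM _ _))// ler_pM ?rnorm_ge0.
have k3 : retr (d * - (P * e * (expA (t *r c') * q))) <=
    nd * (E * (2 * m ^+ 2 * E * h ^+ 2) * (E * E)).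
  apply: le_trans (retr_le _ hd) _; rewrite tnormN// ler_wpM2l//.
  apply: le_trans (tnorm_rnorm tauP _) _; apply: le_trans (rnormM3 _ _ _) _.
  rewrite !ler_pM ?rnorm_ge0 ?mulr_ge0 ?rnorm_ge0//.
  by rewrite (le_trans (rnormM _ _))// ler_pM ?rnorm_ge0.
have k1' : h * nd ^+ 2 <= h * retr (d * P * d * Q) by rewrite ler_wpM2l.
have k2' := ler_wpM2l h0 k2.
rewrite /C; lra.
Qed.

(** The infinitesimal form of the metric increasing property.  Here [k] is the
    coordinate of [e^y] at [e^x]; both [y - x] and the quotient of [e^k - 1 - k]
    by [k] are small with [k], so [expA_increment_ge] compares [y - x] with
    [e^k - 1], and the latter is close to [k]. *)
Lemma metric_increasing_local x (e : R) : selfadj x -> 0 < e -> exists2 h : R, 0 < h &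
  forall y k, selfadj y -> selfadj k ->
    expA y = expA (2^-1 *r x) * expA k * expA (2^-1 *r x) -> rnorm k < h ->
    tnorm (y - x) <= (1 + e) * tnorm k.
Proof.
move=> hx e0; have [K [d0 [K0 d00 lip]]] := log_lipschitz_at hx.
pose m := rnorm x + 1; set E := expR m; pose e1 : R := expR 1.
pose p := expA (2^-1 *r x); pose q := expA (- (2^-1 *r x)).
pose B := rnorm p * (1 + e1) * rnorm p.
have e10 : 0 <= e1 by exact: expR_ge0.
have E0 : 0 <= E by exact: expR_ge0.
have B0 : 0 <= B by do 2 (apply: mulr_ge0; rewrite ?rnorm_ge0//); exact: addr_ge0.
have T0 : 0 <= e1 + (1 + e) * (E ^+ 3 * (K * B)).
  have X0 : 0 <= E ^+ 3 * (K * B) by rewrite mulr_ge0 ?exprn_ge0// mulr_ge0.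
  by rewrite addr_ge0// mulr_ge0// addr_ge0// ltW.
(* Each summand of [S] is a constraint on the norm [h] of [k]: [h < 1], the
   Lipschitz estimate of the logarithm applies, [y - x] has norm below [1], and
   the two error factors fit in [1 + e]. *)
pose S := 1 + B / d0 + K * B + (e1 + (1 + e) * (E ^+ 3 * (K * B))) / e.
have b1 : 0 <= B / d0 by rewrite divr_ge0// ltW.
have b2 : 0 <= K * B by rewrite mulr_ge0.
have b3 : 0 <= (e1 + (1 + e) * (E ^+ 3 * (K * B))) / e by rewrite divr_ge0// ltW.
have S1 : 1 <= S by rewrite /S; lra.
have S0 : 0 < S by lra.
exists S^-1; first by rewrite invr_gt0.
move=> y k hy hk ey; set h := rnorm k => hS; have h0 : 0 <= h by exact: rnorm_ge0.
have hS1 : h * S < 1 by rewrite -ltr_pdivlMr// mul1r.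
have hT w : 0 <= w -> w <= S -> h * w < 1.
  by move=> w0 wS; apply: le_lt_trans hS1; rewrite ler_wpM2l.
have h1 : h < 1 by rewrite -[h]mulr1; apply: hT => //.
have hB : B * h < d0.
  have : h * (B / d0) < 1 by apply: hT => //; rewrite /S; lra.
  by rewrite mulrA ltr_pdivrMr// mul1r mulrC.
have hKB : K * B * h < 1 by rewrite mulrC; apply: hT => //; rewrite /S; lra.
have hT3 : h * (e1 + (1 + e) * (E ^+ 3 * (K * B))) < e.
  by rewrite -[ltRHS]mul1r -ltr_pdivrMr// -mulrA; apply: hT => //; rewrite /S; lra.
have [w ew wb] := expA_expand k; rewrite -/h in wb.
have wb1 : rnorm w <= h * e1.
  by apply: le_trans wb _; rewrite ler_wpM2l// ler_expR ltW.
have ek : expA k - 1 = k * (1 + w).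
  by rewrite ew mulrDr mulr1 [LHS]addrC -(addrA 1) addKr.
have w1 : rnorm (1 + w) <= 1 + h * e1.
  by apply: le_trans (rnormD _ _) _; rewrite lerD// rnorm1_le.
have he1 : h * e1 <= e1 by rewrite ler_piMl// ltW.
have exy : expA y - expA x = p * (expA k - 1) * p.
  by rewrite ey mulrBr mulrBl mulr1 -expA_half.
have Nexy : rnorm (expA y - expA x) <= B * h.
  have k1 : rnorm (expA k - 1) <= h * (1 + e1).
    rewrite ek (le_trans (rnormM _ _))// ler_wpM2l//.
    by apply: le_trans w1 _; rewrite lerD2l.
  have -> : B * h = rnorm p * (h * (1 + e1)) * rnorm p by rewrite /B; ring.
  rewrite exy (le_trans (rnormM3 _ _ _))// ler_wpM2r ?rnorm_ge0//.
  by rewrite ler_wpM2l ?rnorm_ge0.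
have Nyx : rnorm (y - x) <= K * B * h.
  rewrite (le_trans (lip y hy (le_lt_trans Nexy hB)))// -mulrA ler_wpM2l//.
have ym : rnorm y <= m.
  rewrite -[y](subrK x) addrC (le_trans (rnormD _ _))// lerD2l.
  by rewrite (le_trans Nyx)// ltW.
have xm : rnorm x <= m by rewrite lerDl.
have := expA_increment_ge hx hy xm ym; rewrite -/q -/E.
set D := y - x in Nyx *; have hD : selfadj D by exact: selfadjB.
have -> : q * (expA y - expA x) * q = expA k - 1.
  by rewrite exy !mulrA expA_Nmul mul1r -mulrA expA_mulN mulr1.
move=> L1; have L2 := retr_le (expA k - 1) hD.
have L3 : tnorm (expA k - 1) <= tnorm k * (1 + h * e1).
  by rewrite ek (le_trans (tnorm_mulr tauP _ _))// ler_wpM2l ?tnorm_ge0.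
have nD0 := tnorm_ge0 tau D; have nk0 := tnorm_ge0 tau k.
have L4 : tnorm D * (tnorm D * (1 - E ^+ 3 * rnorm D)) <= tnorm D * (tnorm k * (1 + h * e1)).
  by rewrite mulrA -expr2 (le_trans L1)// (le_trans L2)// ler_wpM2l.
have [->|nDn] := eqVneq (tnorm D) 0; first by rewrite mulr_ge0// addr_ge0// ltW.
have nDp : 0 < tnorm D by rewrite lt_def nDn.
rewrite ler_pM2l// in L4.
set X := E ^+ 3 * (K * B) in hT3 T0.
have EX : E ^+ 3 * rnorm D <= X * h by rewrite /X -mulrA ler_wpM2l ?exprn_ge0.
have gap : 1 + h * e1 <= (1 + e) * (1 - X * h) by lra.
have X0 : 0 <= X by rewrite /X mulr_ge0 ?exprn_ge0.
have pos : 0 < 1 - X * h.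
  rewrite -(pmulr_rgt0 _ (_ : 0 < 1 + e)); last by rewrite addr_gt0.
  by apply: lt_le_trans gap; rewrite ltr_wpDr// mulr_ge0.
rewrite -(ler_pM2r pos).
apply: (@le_trans _ _ (tnorm D * (1 - E ^+ 3 * rnorm D))).
  by rewrite ler_wpM2l// lerD2l lerN2.
apply: le_trans L4 _; rewrite mulrAC mulrC ler_wpM2r//.
Qed.

End MetricIncreasing.

(** * Exponential coordinates and the geodesic distance *)

Section Congruence.
Context {R : realType} {V : hilbertType R} {A : vonNeumannType V}.
Variable tau : {scalar A}.
Hypothesis tauP : tracial_state tau.
Implicit Types (x y z a b c d g k u : A) (s t : R).
Local Notation retr := (retr tau).
Local Notation tdot := (tdot tau).
Local Notation tnorm := (tnorm tau).

Definition inverses g g' : Prop := g * g' = 1 /\ g' * g = 1.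

Lemma inversesM g g' z z' : inverses g g' -> inverses z z' -> inverses (g * z) (z' * g').
Proof.
move=> [h1 h2] [h3 h4]; split.
  by rewrite mulrA -(mulrA g) h3 mulr1.
by rewrite mulrA -(mulrA z') h2 mulr1.
Qed.

Lemma inverses_expA x : inverses (expA x) (expA (- x)).
Proof. by split; [exact: expA_mulN|exact: expA_Nmul]. Qed.

Lemma expA_conj u z x : inverses u z -> expA (u * x * z) = u * expA x * z.
Proof.
move=> [uz zu]; apply: (op_cvg_unique (@expA_cvg _ _ _ _)).
have h : (fun n => u * series (exp_term x) n * z) @ \oo --> u * expA x * z.
  by apply: cvgM_op; [apply: cvgM_op|]; [exact: cvg_cst|exact: expA_cvg|exact: cvg_cst].
rewrite (_ : series _ = fun n => u * series (exp_term x) n * z); first exact: h.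
apply/funext => n; rewrite /series /= mulr_sumr mulr_suml; apply: eq_bigr => i _.
rewrite /exp_term op_scaleAr op_scaleAl; congr (_ *: _).
elim: i => [|i ih]; first by rewrite !expr0 mulr1 uz.
by rewrite exprS ih exprS !mulrA -(mulrA (u * x)) zu mulr1.
Qed.

Lemma rnorm_isometry u : star u * u = 1 -> rnorm u <= 1.
Proof.
move=> h; apply: rnorm_min => // v; rewrite mul1r -(@ler_pXn2r _ 2) ?nnegrE ?rnorm_ge0//.
by rewrite -!rdot_sqr rdot_rep -repM -[op_mul _ _]/(star u * u) h rep1.
Qed.

Lemma tnorm_unitary u k : star u * u = 1 -> tnorm (u * k * star u) = tnorm k.
Proof.
move=> h; rewrite /tnorm; congr Num.sqrt; rewrite tdot_mulr// starK -mulrA h mulr1.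
by rewrite tdot_mull// !mulrA h mul1r.
Qed.

(** If [e^x = g (star g)] for an invertible [g] then [e^{-x/2} g] is unitary, and
    conjugation by it changes the base point of exponential coordinates. *)
Lemma polar_coordinates x g g' : selfadj x -> inverses g g' -> g * star g = expA x ->
  exists u, [/\ inverses u (star u), star u * u = 1 &
    forall k, g * expA k * star g =
      expA (2^-1 *r x) * expA (u * k * star u) * expA (2^-1 *r x)].
Proof.
move=> hx [gg' g'g] gx; set p := expA (2^-1 *r x); set q := expA (- (2^-1 *r x)).
have pq : p * q = 1 by exact: expA_mulN.
have qp : q * p = 1 by exact: expA_Nmul.
have sp : star p = p by rewrite (selfadj_expA (selfadjZ 2^-1 hx) : star _ = _).
have sq : star q = q by rewrite (selfadj_expA (selfadjN (selfadjZ 2^-1 hx)) : star _ = _).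
pose u := q * g; have us : star u = star g * q by rewrite /u starM sq.
have uu : u * star u = 1.
  rewrite us /u mulrA -(mulrA q) gx expA_half -/p.
  by rewrite mulrA qp mul1r pq.
have lu : (g' * p) * u = 1 by rewrite /u mulrA -(mulrA g') pq mulr1.
have uu' : star u * u = 1.
  have -> : star u = g' * p by rewrite -[LHS]mul1r -[X in X * _]lu -mulrA uu mulr1.
  exact: lu.
exists u; split=> // k; rewrite (expA_conj k (conj uu uu')) us /u.
rewrite !mulrA pq mul1r -[RHS]mulrA qp mulr1//.
Qed.

(** [g e^k (star g)] is [star z * z] for the invertible [z = e^{k/2} (star g)]. *)
Lemma conj_log g g' k : inverses g g' -> selfadj k ->
  exists2 l, selfadj l & expA l = g * expA k * star g.
Proof.
move=> [gg' g'g] hk; set p := expA (2^-1 *r k); set q := expA (- (2^-1 *r k)).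
have hp : star p = p by rewrite (selfadj_expA (selfadjZ 2^-1 hk) : star _ = _).
have qp : q * p = 1 by exact: expA_Nmul.
have e : g * expA k * star g = star (p * star g) * (p * star g).
  by rewrite starM starK hp expA_half -/p !mulrA.
have hs : selfadj (g * expA k * star g).
  by apply: selfadj_star_mul; exact: selfadj_expA.
have hc : coercive (g * expA k * star g).
  rewrite e; apply: (@coercive_star_mul _ _ A _ (star g' * q)).
  by rewrite mulrA -(mulrA (star g')) qp mulr1 -starM gg' star1.
by have [l [hl el _]] := coercive_log hs hc; exists l.
Qed.

(** The exponential metric increasing property, obtained by integrating
    [metric_increasing_local] along the geodesic [t |-> e^{a/2} e^{t k} e^{a/2}]. *)
Lemma metric_increasing a b k : selfadj a -> selfadj b -> selfadj k ->
  expA b = expA (2^-1 *r a) * expA k * expA (2^-1 *r a) -> tnorm (b - a) <= tnorm k.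
Proof.
move=> ha hb hk eb; set p := expA (2^-1 *r a) in eb.
have hp : star p = p by rewrite (selfadj_expA (selfadjZ 2^-1 ha) : star _ = _).
have pinv : inverses p (expA (- (2^-1 *r a))) by exact: inverses_expA.
pose X t := p * expA (t *r k) * p.
have exl t : exists2 l, selfadj l & expA l = X t.
  have [l hl el] := conj_log pinv (selfadjZ t hk).
  by exists l => //; rewrite el hp.
pose c t := logA (X t).
have hc t : selfadj (c t) /\ expA (c t) = X t.
  by have [l hl el] := exl t; rewrite /c -el logA_expA.
have c0 : c 0 = a by rewrite /c /X scale0r expA0 mulr1 -expA_half logA_expA.
have c1 : c 1 = b by rewrite /c /X scale1r -eb logA_expA.
have := @dini_le_linear R (fun t => tnorm (c t - a)) (tnorm k).
rewrite c0 c1 subrr /tnorm /tdot mulr0 /retr linear0 sqrtr0 add0r; apply => t e t01 e0.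
have nk0 := tnorm_ge0 tau k.
have e' : 0 < e / (tnorm k + 1) by rewrite divr_gt0// ltr_wpDl.
have [h h0 loc] := metric_increasing_local tauP (hc t).1 e'.
have kk : 0 < rnorm k + 1 by rewrite ltr_wpDl ?rnorm_ge0.
exists (h / (rnorm k + 1)) => [|s s01]; first by rewrite divr_gt0.
rewrite ltr_pdivlMr// => hs.
pose g := p * expA (2^-1 *r (t *r k)).
have ginv := inversesM pinv (inverses_expA (2^-1 *r (t *r k))); rewrite -/g in ginv.
have sg : star g = expA (2^-1 *r (t *r k)) * p.
  by rewrite /g starM hp (selfadj_expA (selfadjZ 2^-1 (selfadjZ t hk)) : star _ = _).
have gg : g * star g = expA (c t).
  by rewrite (hc t).2 sg /g /X mulrA -(mulrA p) -expA_half.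
have [u [uinv uu uk]] := polar_coordinates (hc t).1 ginv gg.
have hu := rnorm_isometry uu.
set dk := (s - t) *r k; have hdk : selfadj dk by exact: selfadjZ.
have ecs : expA (c s) = expA (2^-1 *r c t) * expA (u * dk * star u) * expA (2^-1 *r c t).
  rewrite -uk (hc s).2 sg /g /X; set w := expA (2^-1 *r (t *r k)).
  have -> : p * w * expA dk * (w * p) = p * (w * (expA dk * w)) * p by rewrite !mulrA.
  congr (p * _ * p); rewrite /w /dk !rscaleA.
  by rewrite (@expA_scale_eq _ _ _ _ _ (s - t / 2)) ?(@expA_scale_eq _ _ _ _ _ s)//; lra.
have hudk : selfadj (u * dk * star u) by exact: selfadj_star_mul.
have nudk : rnorm (u * dk * star u) < h.
  apply: le_lt_trans (rnormM3 _ _ _) _; rewrite rnorm_star.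
  apply: (@le_lt_trans _ _ (1 * rnorm dk * 1)).
    by rewrite !ler_pM ?mulr_ge0 ?rnorm_ge0.
  rewrite mul1r mulr1 rnormZ; apply: le_lt_trans hs.
  by rewrite ler_wpM2l// lerDl.
have := loc _ _ (hc s).1 hudk ecs nudk; rewrite tnorm_unitary// tnormZ// => main.
have bound : tnorm (c s - c t) <= (tnorm k + e) * `|s - t|.
  apply: le_trans main _; rewrite mulrCA mulrC ler_wpM2r//.
  rewrite mulrDl mul1r lerD2l mulrAC ler_pdivrMr ?ltr_wpDl//.
  by rewrite ler_wpM2l ?(ltW e0)// lerDl.
have tri := le_trans (tnorm_dist tauP (c s - a) (c t - a)); move: tri.
rewrite opprB addrA subrK => /(_ _ bound);
rewrite ler_norml -!/(tdot _ _) -!/(tnorm _) => /andP[b1 b2].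
by split=> st; [rewrite ger0_norm ?subr_ge0// in b2|rewrite ler0_norm ?subr_le0// in b1]; lra.
Qed.

(** The length of the geodesic from [x] to [y], read off in the exponential
    coordinates at [x]. *)
Definition gdist x y : R :=
  tnorm (logA (powA x (- 2^-1) * y * powA x (- 2^-1))).

Lemma gdist_ge0 x y : 0 <= gdist x y.
Proof. exact: tnorm_ge0. Qed.

(** The polar decomposition changes the coordinate [k] into a unitary conjugate
    of [k], which has the same trace norm. *)
Lemma gdist_coord g g' k : inverses g g' -> selfadj k ->
  gdist (g * star g) (g * expA k * star g) = tnorm k.
Proof.
move=> ginv hk.
have [x hx ex] := conj_log ginv (selfadjZ 0 hk).
rewrite scale0r expA0 mulr1 in ex.
have [u [uinv uu uk]] := polar_coordinates hx ginv (esym ex).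
rewrite /gdist -ex powA_expA// uk rscaleN !mulrA expA_Nmul mul1r.
rewrite -mulrA expA_mulN mulr1 logA_expA ?tnorm_unitary//.
exact: selfadj_star_mul.
Qed.

Lemma coord_at g g' b : inverses g g' -> Sigma b ->
  exists2 k, selfadj k & b = g * expA k * star g.
Proof.
move=> [gg' g'g] [x hx <-].
have inv' : inverses g' g by [].
have [k hk ek] := conj_log inv' hx; exists k => //.
rewrite ek !mulrA gg' mul1r -mulrA -starM gg' star1 mulr1//.
Qed.

Lemma Sigma_coord g g' k : inverses g g' -> selfadj k -> Sigma (g * expA k * star g).
Proof. by move=> ginv hk; have [l hl <-] := conj_log ginv hk; exists l. Qed.

(** Nonpositive curvature: passing to the exponential coordinates at [g (star g)]
    does not increase distances.  With [g e^{a/2}] in place of [g] this is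
    [metric_increasing]. *)
Lemma gdist_coord_ge g g' a b : inverses g g' -> selfadj a -> selfadj b ->
  tnorm (a - b) <= gdist (g * expA a * star g) (g * expA b * star g).
Proof.
move=> ginv ha hb; set p := expA (2^-1 *r a).
have hp : star p = p by rewrite (selfadj_expA (selfadjZ 2^-1 ha) : star _ = _).
have pinv : inverses p (expA (- (2^-1 *r a))) by exact: inverses_expA.
have [k hk ek] : exists2 k, selfadj k & expA b = p * expA k * star p.
  by apply: (coord_at pinv); exists b.
have -> : g * expA a * star g = (g * p) * star (g * p).
  by rewrite starM hp !mulrA -(mulrA g p) -expA_half.
have -> : g * expA b * star g = (g * p) * expA k * star (g * p).
  by rewrite ek starM !mulrA.
rewrite (gdist_coord (inversesM ginv pinv) hk) -tnormN// opprB.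
by apply: metric_increasing => //; rewrite ek hp.
Qed.

Lemma gdistC x y : Sigma x -> Sigma y -> gdist x y = gdist y x.
Proof.
move=> [a ha <-] hy; have pinv := inverses_expA (2^-1 *r a).
have hp : star (expA (2^-1 *r a)) = expA (2^-1 *r a).
  exact: (selfadj_expA (selfadjZ 2^-1 ha)).
have [k hk ->] := coord_at pinv hy.
have ex : expA a = expA (2^-1 *r a) * star (expA (2^-1 *r a)) by rewrite hp -expA_half.
rewrite {1}ex (gdist_coord pinv hk).
set p := expA (2^-1 *r a) in hp ex pinv *; set m := expA (2^-1 *r k).
have hm : star m = m by exact: (selfadj_expA (selfadjZ 2^-1 hk)).
have ginv := inversesM pinv (inverses_expA (2^-1 *r k)); rewrite -/m in ginv.
have -> : p * expA k * star p = (p * m) * star (p * m).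
  by rewrite starM hm !mulrA -(mulrA p m) -expA_half.
have -> : expA a = (p * m) * expA (- k) * star (p * m).
  rewrite starM hm !mulrA -(mulrA (p * m)) -(mulrA p).
  have -> : m * (expA (- k) * m) = 1.
    rewrite -{1}[k]half_D opprD expAD; last by rewrite -rscaleN; exact: comm_scale.
    by rewrite !mulrA expA_mulN mul1r expA_Nmul.
  by rewrite mulr1.
by rewrite (gdist_coord ginv (selfadjN hk)) tnormN.
Qed.

End Congruence.

(** * Comparison inequalities *)

Section Comparison.
Context {R : realType} {V : hilbertType R} {A : vonNeumannType V}.
Variable tau : {scalar A}.
Hypothesis tauP : tracial_state tau.
Implicit Types (x y z a b c d g k u v w p q r : A) (s t : R).
Local Notation retr := (retr tau).
Local Notation tdot := (tdot tau).
Local Notation tnorm := (tnorm tau).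
Local Notation gdist := (gdist tau).

(** Over [n] equal steps the differences of [h] contribute [(h 0 - h 1) / n]. *)
Lemma telescoping_increments_le (f h : R -> R) (c : R) :
  (forall s t, 0 <= s -> s <= t -> t <= 1 ->
     f t - f s <= (t - s) * (c + (h s - h t))) -> f 1 - f 0 <= c.
Proof.
move=> H; rewrite leNgt; apply/negP => lt.
set e := f 1 - f 0 - c; have e0 : 0 < e by rewrite subr_gt0.
pose n := (Num.truncn (`|h 0 - h 1| / e)).+1.
have n0 : 0 < n%:R :> R by rewrite ltr0n.
have step i : (i <= n)%N ->
    f (i%:R / n%:R) - f 0 <= n%:R^-1 * (i%:R * c + (h 0 - h (i%:R / n%:R))).
  elim: i => [|i ih] ilen; first by rewrite !mul0r !subrr add0r mulr0.
  have := H (i%:R / n%:R) (i.+1%:R / n%:R).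
  rewrite divr_ge0// ler_pM2r ?invr_gt0// ler_nat leqnSn ler_pdivrMr// mul1r ler_nat.
  move=> /(_ isT isT ilen).
  rewrite -mulrBl -natrB// subSnn mul1r => H1; have := ih (ltnW ilen).
  by set u := i.+1%:R / _ in H1 *; rewrite -natr1; lra.
have := step n (leqnn n); rewrite divff ?gt_eqF// mulrDr mulrA mulVf ?gt_eqF// mul1r.
have : n%:R^-1 * (h 0 - h 1) < e.
  rewrite mulrC ltr_pdivrMr//; apply: le_lt_trans (ler_norm _) _.
  by rewrite mulrC -ltr_pdivrMr// /n truncnS_gt.
by rewrite /e; set u := n%:R^-1 * _; lra.
Qed.

(** Reshetnyak's quadrilateral inequality.  Along the geodesic from [y] to [z],
    parametrised with velocity [k] in the coordinates at each of its points, let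
    [P t] and [Q t] be the coordinates of [p] and [q].  For [s <= t], the metric
    increasing property in the coordinates at [t] for [p], and in those at [s] for
    [q], bounds the increment of [tnorm P ^+ 2 - tnorm Q ^+ 2] by
    [2 (t - s) (tdot (Q s) k - tdot (P t) k)].  Replacing [P t] by [P s] costs a
    telescoping term, and [tnorm (Q s - P s)] is at most the distance of [p] and
    [q]. *)
Lemma quadrilateral_le p q y z : Sigma p -> Sigma q -> Sigma y -> Sigma z ->
  gdist p z ^+ 2 - gdist q z ^+ 2 - gdist p y ^+ 2 + gdist q y ^+ 2
  <= 2 * (gdist p q * gdist y z).
Proof.
move=> Sp Sq [a ha <-] Ss; set g0 := expA (2^-1 *r a).
have hg0 : star g0 = g0 by exact: (selfadj_expA (selfadjZ 2^-1 ha)).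
have [k hk es] := coord_at (inverses_expA (2^-1 *r a)) Ss; rewrite -/g0 hg0 in es.
pose g t := g0 * expA ((t / 2) *r k).
have sgt t : star (expA ((t / 2) *r k)) = expA ((t / 2) *r k).
  exact: (selfadj_expA (selfadjZ (t / 2) hk)).
have ginv t : inverses (g t) (expA (- ((t / 2) *r k)) * expA (- (2^-1 *r a))).
  exact: inversesM (inverses_expA _) (inverses_expA _).
pose x t := g0 * expA (t *r k) * g0.
have xg s t : x s = g t * expA ((s - t) *r k) * star (g t).
  rewrite /x /g starM hg0 sgt; set w := expA ((t / 2) *r k).
  have -> : g0 * w * expA ((s - t) *r k) * (w * g0) =
    g0 * (w * (expA ((s - t) *r k) * w)) * g0 by rewrite !mulrA.
  congr (g0 * _ * g0); rewrite /w.
  by rewrite (@expA_scale_eq _ _ _ _ _ (s - t / 2)) ?(@expA_scale_eq _ _ _ _ _ s)//; lra.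
have xgg t : x t = g t * star (g t) by rewrite (xg t t) subrr scale0r expA0 mulr1.
have Sx t : Sigma (x t).
  by rewrite (xg t t); apply: Sigma_coord (ginv t) _; exact: selfadjZ.
have x0 : x 0 = expA a by rewrite /x scale0r expA0 mulr1 /g0 -expA_half.
have x1 : x 1 = z by rewrite /x scale1r -es.
have coords o : Sigma o -> exists P : R -> A,
    forall t, selfadj (P t) /\ o = g t * expA (P t) * star (g t).
  move=> Sy; have /choice[P hP] : forall t, exists l, selfadj l /\
      o = g t * expA l * star (g t).
    by move=> t; have [l hl el] := coord_at (ginv t) Sy; exists l.
  by exists P.
have [P hP] := coords p Sp; have [Q hQ] := coords q Sq.
have dx o Y : Sigma o -> (forall t, selfadj (Y t) /\ o = g t * expA (Y t) * star (g t)) ->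
    forall t, gdist o (x t) = tnorm (Y t).
  move=> Sy hY t; rewrite gdistC// {1}(hY t).2 xgg.
  exact: (gdist_coord tauP (ginv t) (hY t).1).
have cosines o Y : Sigma o -> (forall t, selfadj (Y t) /\ o = g t * expA (Y t) * star (g t)) ->
    forall s t, tnorm (Y t) ^+ 2 - 2 * ((s - t) * tdot (Y t) k) <= tnorm (Y s) ^+ 2.
  move=> Sy hY s t; have := gdist_coord_ge tauP (ginv t) (hY t).1 (selfadjZ (s - t) hk).
  rewrite -(hY t).2 -xg (dx o Y)// => h.
  have : tnorm (Y t - (s - t) *r k) ^+ 2 <= tnorm (Y s) ^+ 2.
    by rewrite lerXn2r ?nnegrE ?tnorm_ge0.
  rewrite tnorm_sqr// tdotBl !(tdotBr tauP) !tdotZl !(tdotZr tauP) (tdotC tauP k) -tnorm_sqr//.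
  have : 0 <= (s - t) ^+ 2 * tdot k k by rewrite mulr_ge0 ?sqr_ge0 ?tdot_ge0.
  lra.
have pq : gdist p q = gdist q p by exact: gdistC.
have QP t : tdot (Q t - P t) k <= gdist p q * tnorm k.
  apply: le_trans (tdot_le tauP _ _) _; rewrite ler_wpM2r ?tnorm_ge0// pq.
  rewrite {1}(hQ t).2 {1}(hP t).2.
  exact: (gdist_coord_ge tauP (ginv t) (hQ t).1 (hP t).1).
have rs : gdist (expA a) z = tnorm k.
  rewrite -x0 -x1 (xgg 0) (xg 1 0) subr0 scale1r.
  exact: (gdist_coord tauP (ginv 0) hk).
rewrite rs -x0 -x1 !(dx p P)// !(dx q Q)//.
have := @telescoping_increments_le (fun t => tnorm (P t) ^+ 2 - tnorm (Q t) ^+ 2)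
  (fun t => 2 * tdot (P t) k) (2 * (gdist p q * tnorm k)).
have shape (A1 A2 A3 A4 B : R) : A1 - A2 - (A3 - A4) <= B -> A1 - A2 - A3 + A4 <= B by lra.
move=> T; apply: shape; apply: T => s t s0 st t1.
have c1 := cosines p P Sp hP s t; have c2 := cosines q Q Sq hQ t s.
have q1 := QP s; rewrite tdotBl in q1.
have ts : 0 <= t - s by rewrite subr_ge0.
have q2 := ler_wpM2l ts q1.
lra.
Qed.

(** Right angles at [p] and at [q] bound the two diagonals of the quadrilateral
    from below; [quadrilateral_le] bounds them from above. *)
Lemma quadrilateral_contract p q y z : Sigma p -> Sigma q -> Sigma y -> Sigma z ->
  gdist p q ^+ 2 + gdist p y ^+ 2 <= gdist q y ^+ 2 ->
  gdist q p ^+ 2 + gdist q z ^+ 2 <= gdist p z ^+ 2 ->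
  gdist p q <= gdist y z.
Proof.
move=> Sp Sq Sr Ss h1 h2; have := quadrilateral_le Sp Sq Sr Ss.
rewrite (gdistC tauP Sq Sp) in h2; move=> h3.
have [->|n0] := eqVneq (gdist p q) 0; first exact: gdist_ge0.
have pos : 0 < gdist p q by rewrite lt_def n0 gdist_ge0.
by rewrite -(ler_pM2l pos) -expr2; lra.
Qed.

Section ConvexSet.
Variable H : set A.
Hypothesis Hsub : closed_real_subspace H.
Hypothesis Hconv : g_convex (exponential_set H).

Let Hsa a : H a -> selfadj a. Proof. by have [h _ _ _ _] := Hsub; exact: h. Qed.
Let HZ t a : H a -> H (t *r a). Proof. by have [_ _ _ h _] := Hsub; exact: h. Qed.

(** [y x^{-1} y] is the point at parameter [2] of the geodesic from [x] to [y],
    so a convex exponential set is stable under it; here [x = e^{-b}] and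
    [y = e^{-a/2}]. *)
Lemma convex_log a b : H a -> H b -> exists2 k, H k &
  expA k = expA (- (2^-1 *r a)) * expA b * expA (- (2^-1 *r a)).
Proof.
move=> Ha Hb; have [sa sb] := (Hsa Ha, Hsa Hb).
have Hy : exponential_set H (expA ((- 2^-1) *r a)) by exists ((- 2^-1) *r a) => //; exact: HZ.
have Hx : exponential_set H (expA ((-1) *r b)) by exists ((-1) *r b) => //; exact: HZ.
have [k Hk ek] := Hconv 2 Hx Hy; exists k => //; rewrite ek /geodesic.
have sNb : selfadj ((-1) *r b) by exact: selfadjZ.
rewrite !powA_expA// !rscaleA -!rscaleN.
set u := expA ((2^-1 * -1) *r b); set u' := expA ((- 2^-1 * -1) *r b).
set y := expA ((- 2^-1) *r a).
have su : star u' = u' by exact: (selfadj_expA (selfadjZ _ sb)).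
have uu' : u * u' = 1.
  by rewrite /u /u' (@expA_scale_eq _ _ _ _ _ 0) ?scale0r ?expA0//; lra.
have u'u : u' * u = 1.
  by rewrite /u /u' (@expA_scale_eq _ _ _ _ _ 0) ?scale0r ?expA0//; lra.
have [l hl el] := conj_log (conj u'u uu') (selfadjZ (- 2^-1) sa).
rewrite su -/y in el; rewrite -[op_mul (op_mul u' y) u']/(u' * y * u').
rewrite -el powA_expA// (_ : expA (2 *r l) = expA l * expA l); last first.
  by rewrite -{2 3}[l]scale1r (@expA_scale_eq _ _ _ _ _ 2)//; lra.
rewrite el -[LHS]/(u * (u' * y * u' * (u' * y * u')) * u) !mulrA uu' mul1r.
rewrite -[LHS]mulrA u'u mulr1 -(mulrA y) /u' (@expA_scale_eq _ _ _ _ _ 1) ?scale1r//; lra.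
Qed.

(** The logarithm of [q = e^b] at [p = e^a] lies in [H], so the tangent vector of
    the geodesic from [p] to [q] is orthogonal to the normal vector [v]. *)
Lemma normal_pythagoras a b v : H a -> H b -> Defs.normal_space tau H (expA a) v ->
  Sigma (Exp (expA a) v) /\
  gdist (expA a) (expA b) ^+ 2 + gdist (expA a) (Exp (expA a) v) ^+ 2
    <= gdist (expA b) (Exp (expA a) v) ^+ 2.
Proof.
move=> Ha Hb [sv ortho]; have sa := Hsa Ha.
set g := expA (2^-1 *r a); set q := expA (- (2^-1 *r a)).
have sg : star g = g by exact: (selfadj_expA (selfadjZ _ sa)).
have sq : star q = q by exact: (selfadj_expA (selfadjN (selfadjZ _ sa))).
have ginv : inverses g q by exact: inverses_expA.
have [gq qg] := ginv.
have [k Hk ek] := convex_log Ha Hb; rewrite -/q in ek; have sk := Hsa Hk.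
set v' := q * v * q.
have sv' : selfadj v' by rewrite /v' -{2}sq; exact: selfadj_star_mul.
have eE : Exp (expA a) v = g * expA v' * star g.
  by rewrite /Exp !powA_expA// rscaleN sg.
have eb : expA b = g * expA k * star g.
  by rewrite ek sg !mulrA gq mul1r -mulrA qg mulr1.
have ea : expA a = g * star g by rewrite sg /g -expA_half.
have kv : tdot k v' = 0.
  have tk : tangent H (expA a) (g * k * g) by exists k => //; rewrite powA_expA.
  have := congr1 (@complex.Re R) (ortho _ tk).
  rewrite /inner invA_expA.
  have -> : expA (- a) = q * q.
    by rewrite /q -expAD ?half_D -?opprD ?half_D.
  rewrite -[X in complex.Re (tau X)]/(v * (q * q) * (g * k * g) * (q * q)) -/(retr _).
  have -> : v * (q * q) * (g * k * g) * (q * q) = v * q * (q * g) * k * (g * q) * q.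
    by rewrite !mulrA.
  rewrite gq qg !mulr1 retrC// /tdot (sv' : star v' = v') /v' => h.
  by move: h; rewrite !mulrA.
rewrite eE eb {1 2}ea; split; first exact: Sigma_coord ginv sv'.
rewrite !(gdist_coord tauP ginv)//.
have := gdist_coord_ge tauP ginv sk sv' => h.
have : tnorm (k - v') ^+ 2 <= gdist (g * expA k * star g) (g * expA v' * star g) ^+ 2.
  by rewrite lerXn2r ?nnegrE ?tnorm_ge0 ?gdist_ge0.
apply: le_trans; rewrite (tnorm_sqr tauP (k - v')) tdotBl !(tdotBr tauP)
  (tdotC tauP v' k) kv -!tnorm_sqr//; lra.
Qed.

End ConvexSet.

End Comparison.

(** * Integrals and increments *)

Section RealIntegral.
Context {R : realType}.
Implicit Types (f G : R -> R) (s t : R).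
Local Notation mu := (@lebesgue_measure R).

Lemma integral_increment_ge f (c : R) s t : {within `[0, 1], continuous f} ->
  0 <= t -> t <= s -> s <= 1 -> (forall x, t <= x <= s -> c <= f x) ->
  c * (s - t) <= \int[mu]_(x in `[0, s]) f x - \int[mu]_(x in `[0, t]) f x.
Proof.
move=> fc t0 ts s1 cf.
have if01 : mu.-integrable `[0, 1] (EFin \o f).
  by apply: continuous_compact_integrable => //; exact: segment_compact.
have if0s : mu.-integrable `[0, s] (EFin \o f).
  apply: integrableS if01 => //; apply: subset_itvl; rewrite bnd_simp//.
rewrite Rintegral_itvB// ?bnd_simp//.
have mts : measurable (`]t, s] : set R) by exact: measurable_itv.
have <- : \int[mu]_(x in `]t, s]) c = c * (s - t).
  rewrite Rintegral_cst//= lebesgue_measure_itv/= lte_fin.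
  case: ltP => [//|st]; have -> : s = t by apply: le_anti; rewrite st.
  by rewrite subrr.
apply: le_Rintegral => //.
- have ic : mu.-integrable `[t, s] (EFin \o (fun=> c)).
    apply: continuous_compact_integrable => [|?]; first exact: segment_compact.
    exact: cvg_cst.
  apply: integrableS ic => //; exact: subset_itv_oc_cc.
- apply: integrableS if0s => //; apply: subset_itvr; rewrite bnd_simp//.
- by move=> x /=; rewrite in_itv/= => /andP[/ltW tx xs]; apply: cf; rewrite tx.
Qed.

(** [dini_le] for [G] minus the indefinite integral of [f]. *)
Lemma increment_le_integral G f : {within `[0, 1], continuous f} ->
  (forall t e, 0 <= t <= 1 -> 0 < e -> exists2 d, 0 < d &
     forall s, 0 <= s <= 1 -> `|s - t| < d -> `|G s - G t| <= (f t + e) * `|s - t|) ->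
  G 1 - G 0 <= \int[mu]_(x in `[0, 1]) f x.
Proof.
move=> fc hG; pose S t := \int[mu]_(x in `[0, t]) f x.
have S0 : S 0 = 0 by rewrite /S set_itv1 Rintegral_set1.
have := @dini_le R (fun t => G t - S t); rewrite S0 subr0 -/(S 1).
suff h : forall t e, 0 <= t <= 1 -> 0 < e -> exists2 d, 0 < d &
     forall s, 0 <= s <= 1 -> `|s - t| < d ->
       (t <= s -> G s - S s - (G t - S t) <= e * (s - t)) /\
       (s <= t -> G t - S t - (G s - S s) <= e * (t - s)).
  by move=> /(_ h); lra.
move=> t e t01 e0; have e2 : 0 < e / 2 by rewrite divr_gt0.
have [d1 d10 h1] := hG t _ t01 e2.
have t01' : [set` `[0, 1]] t by rewrite /= in_itv.
have /cvgrPdist_lt/(_ _ e2) := (subspace_continuousP _ _).1 fc t t01'.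
rewrite near_withinE => /nbhs_ballP[d2 d20 h2].
exists (Num.min d1 d2) => [|s s01]; first by rewrite lt_min d10.
rewrite lt_min => /andP[st1 st2].
have near_f x : 0 <= x <= 1 -> `|x - t| <= `|s - t| -> f t - e / 2 <= f x.
  move=> x01 xs; have := h2 x; rewrite /ball/= distrC => /(_ (le_lt_trans xs st2)).
  by rewrite in_itv/= => /(_ x01) /ltr_normlP[h3 h4]; rewrite lerBlDr -lerBlDl ltW.
have := h1 s s01 st1; rewrite ler_norml => /andP[g1 g2].
have [/andP[s0 s1] /andP[t0 t1]] := (s01, t01).
split=> st.
- have := @integral_increment_ge f (f t - e / 2) s t fc t0 st s1.
  rewrite -/(S s) -/(S t) => h.
  have {}h : (f t - e / 2) * (s - t) <= S s - S t.
    apply: h => x /andP[tx xs]; apply: near_f; first by lra.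
    by rewrite !ger0_norm ?subr_ge0// lerD2r.
  by rewrite ger0_norm ?subr_ge0// in g2; lra.
- have := @integral_increment_ge f (f t - e / 2) t s fc s0 st t1.
  rewrite -/(S s) -/(S t) => h.
  have {}h : (f t - e / 2) * (t - s) <= S t - S s.
    apply: h => x /andP[tx xs]; apply: near_f; first by lra.
    by rewrite !ler0_norm ?subr_le0// lerN2 lerD2r.
  by rewrite ler0_norm ?subr_le0// opprB in g1; lra.
Qed.

End RealIntegral.

(** * Velocities of curves *)

Section Curves.
Context {R : realType} {V : hilbertType R} {A : vonNeumannType V}.
Implicit Types (a b c v x y z k g : A) (s t : R) (gamma : R -> A).

Definition slopes t := within [set h : R | t + h \in `[0, 1]] (0^' : set_system R).

Lemma near_slopesP t (P : set R) : (\forall h \near slopes t, P h) <->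
  exists2 d : R, 0 < d & forall h, h != 0 -> `|h| < d -> t + h \in `[0, 1] -> P h.
Proof.
rewrite /slopes near_withinE; split.
  move=> /nbhs_ballP[d d0 hd]; exists d => // h h0 hN th; apply: hd => //.
  by rewrite /ball/= sub0r normrN.
move=> [d d0 hd]; apply/nbhs_ballP; exists d => // h; rewrite /ball/= sub0r normrN => hN h0 th.
exact: hd.
Qed.

Lemma slopes_proper t : 0 <= t <= 1 -> ProperFilter (slopes t).
Proof.
move=> /andP[t0 t1]; apply: Build_ProperFilter_ex => P /near_slopesP[d d0 hd].
have [t2|t2] := leP t (1 / 2).
  exists (Num.min (d / 2) (1 / 2)); have m0 : 0 < Num.min (d / 2) (1 / 2) :> R.
    by rewrite lt_min !divr_gt0.
  have m1 : Num.min (d / 2) (1 / 2) <= d / 2 by rewrite ge_min lexx.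
  have m2 : Num.min (d / 2) (1 / 2) <= 1 / 2 :> R by rewrite ge_min lexx orbT.
  apply: hd; first by rewrite gt_eqF.
    by rewrite gtr0_norm//; lra.
  by rewrite in_itv/=; lra.
exists (- Num.min (d / 2) (1 / 2)); have m0 : 0 < Num.min (d / 2) (1 / 2) :> R.
  by rewrite lt_min !divr_gt0.
have m1 : Num.min (d / 2) (1 / 2) <= d / 2 by rewrite ge_min lexx.
have m2 : Num.min (d / 2) (1 / 2) <= 1 / 2 :> R by rewrite ge_min lexx orbT.
apply: hd; first by rewrite oppr_eq0 gt_eqF.
  by rewrite normrN gtr0_norm//; lra.
by rewrite in_itv/=; lra.
Qed.

Lemma diff_quotientE gamma t (F : set_system A) :
  (diff_quotient gamma t --> F) =
  ((fun h => h^-1 *r (gamma (t + h) - gamma t)) @ slopes t --> F).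
Proof. by []. Qed.

Lemma velocity_eq gamma t v : 0 <= t <= 1 -> diff_quotient gamma t --> v ->
  velocity gamma t = v.
Proof.
move=> t01; rewrite diff_quotientE => h.
have pf := slopes_proper t01; exact: (@cvg_lim _ (@norm_hausdorff _ A) _ _ pf _ _ h).
Qed.

Lemma velocity_cvg gamma t : cvg (diff_quotient gamma t) ->
  diff_quotient gamma t --> velocity gamma t.
Proof. by []. Qed.

Lemma velocity_selfadj gamma t : 0 <= t <= 1 ->
  (forall s, 0 <= s <= 1 -> selfadj (gamma s)) -> cvg (diff_quotient gamma t) ->
  selfadj (velocity gamma t).
Proof.
move=> t01 sg /velocity_cvg; rewrite diff_quotientE => h.
have pf := slopes_proper t01.
have h2 : (fun u => u^-1 *r (gamma (t + u) - gamma t)) @ slopes t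
    --> star (velocity gamma t).
  apply: cvg_trans (cvg_star h); apply: near_eq_cvg.
  apply/near_slopesP; exists 1 => // u u0 _; rewrite in_itv/= => tu.
  by rewrite starZr starB (sg t t01 : star _ = _) (sg (t + u) tu : star _ = _).
exact: op_cvg_unique h2 h.
Qed.

Lemma velocity_expansion gamma t (e : R) : 0 <= t <= 1 -> 0 < e ->
  cvg (diff_quotient gamma t) -> exists2 d, 0 < d &
  forall s, 0 <= s <= 1 -> `|s - t| < d -> exists2 z,
    gamma s = gamma t + (s - t) *r (velocity gamma t + z) & rnorm z < e.
Proof.
move=> t01 e0 /velocity_cvg; rewrite diff_quotientE => /cvg_rnormP/(_ e e0).
have pf := slopes_proper t01; move=> /near_slopesP[d d0 hd].
exists d => // s s01 st; have [->|n0] := eqVneq s t.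
  by exists 0; rewrite ?subrr ?scale0r ?addr0 ?rnorm0.
have st0 : s - t != 0 by rewrite subr_eq0.
have ts : t + (s - t) = s by rewrite addrC subrK.
have := hd (s - t) st0 st; rewrite ts in_itv/= s01 => /(_ isT).
set w := _ *r _ => wd; exists (w - velocity gamma t); last by rewrite rnormBC.
by rewrite [velocity _ _ + _]addrC subrK /w rscaleA divff// scale1r addrC subrK.
Qed.

Lemma curve_cvg gamma t : 0 <= t <= 1 -> cvg (diff_quotient gamma t) ->
  gamma @ within `[0, 1] (nbhs t) --> gamma t.
Proof.
move=> t01 cv; have [d d0 hd] := velocity_expansion t01 ltr01 cv.
apply/cvg_rnormP => e e0; rewrite near_withinE; apply/nbhs_ballP.
set m := rnorm (velocity gamma t) + 1.
have m0 : 0 < m by rewrite ltr_wpDl ?rnorm_ge0.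
exists (Num.min d (e / m)) => /=; first by rewrite lt_min d0 divr_gt0.
move=> s; rewrite /ball/= distrC lt_min => /andP[sd se]; rewrite in_itv/= => s01.
have [z -> zN] := hd s s01 sd.
rewrite opprD addrA subrr add0r rnormN rnormZ.
apply: le_lt_trans (_ : `|s - t| * m < _).
  by rewrite ler_wpM2l// (le_trans (rnormD _ _))// lerD2l ltW.
by rewrite -ltr_pdivlMr.
Qed.

End Curves.

(** * Lengths of curves *)

Section Lengths.
Context {R : realType} {V : hilbertType R} {A : vonNeumannType V}.
Variable tau : {scalar A}.
Hypothesis tauP : tracial_state tau.
Implicit Types (a b c v x y z k g p q : A) (s t : R) (gamma : R -> A).
Local Notation retr := (retr tau).
Local Notation tdot := (tdot tau).
Local Notation tnorm := (tnorm tau).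
Local Notation gdist := (gdist tau).

Lemma norm_atE x v : selfadj x -> selfadj v ->
  norm_at tau (expA x) v = tnorm (expA (- (2^-1 *r x)) * v * expA (- (2^-1 *r x))).
Proof.
move=> hx hv; set q := expA (- _).
have sq : star q = q by exact: (selfadj_expA (selfadjN (selfadjZ _ hx))).
rewrite /norm_at /inner invA_expA /tnorm; congr Num.sqrt.
have -> : expA (- x) = q * q by rewrite /q -expAD ?half_D -?opprD ?half_D.
rewrite -[X in complex.Re (tau X)]/(v * (q * q) * v * (q * q)) -/(retr _).
rewrite /tdot !starM sq (hv : star v = v) retrC// !mulrA retrC// !mulrA retrC// !mulrA.
by rewrite [RHS]retrC// !mulrA [LHS]retrC// !mulrA.
Qed.

Lemma cvg_tnorm {T} {F : set_system T} {FF : Filter F} (f : T -> A) x :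
  f @ F --> x -> (fun i => tnorm (f i)) @ F --> tnorm x.
Proof.
move=> /cvg_rnormP fx; apply/cvgrPdist_lt => e e0; apply: filterS (fx e e0) => i.
apply: le_lt_trans; apply: le_trans (tnorm_dist tauP _ _) _; exact: tnorm_rnorm.
Qed.

Lemma cvg_expA {T} {F : set_system T} {FF : Filter F} (f : T -> A) x :
  f @ F --> x -> (fun i => expA (f i)) @ F --> expA x.
Proof.
move=> /cvg_rnormP fx; apply/cvg_rnormP => e e0.
set m := rnorm x + 1; have E0 := expR_gt0 m.
have d0 : 0 < Num.min 1 (e / expR m) by rewrite lt_min ltr01 divr_gt0.
apply: filterS (fx _ d0) => i; rewrite lt_min => /andP[h1 h2].
have xm : rnorm x <= m by rewrite lerDl.
have fm : rnorm (f i) <= m.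
  have := rnormB x (x - f i); rewrite subKr => h; apply: le_trans h _.
  by rewrite lerD2l ltW.
apply: le_lt_trans (expA_lipschitz xm fm) _.
by rewrite mulrC -ltr_pdivlMr.
Qed.

Lemma cvg_logA {T} {F : set_system T} {FF : Filter F} (f : T -> A) x :
  Sigma x -> (\forall i \near F, Sigma (f i)) -> f @ F --> x ->
  (fun i => logA (f i)) @ F --> logA x.
Proof.
move=> [a ha <-] Sf /cvg_rnormP fx; apply/cvg_rnormP => e e0; rewrite logA_expA//.
have [K [d [K0 d0 lip]]] := log_lipschitz_at ha.
have m0 : 0 < Num.min d (e / (K + 1)) by rewrite lt_min d0 divr_gt0// ltr_wpDl.
apply: filterS2 Sf (fx _ m0) => i [b hb <-]; rewrite lt_min => /andP[h1 h2].
rewrite logA_expA// rnormBC; rewrite rnormBC in h1 h2.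
apply: le_lt_trans (lip b hb h1) _; move: h2; rewrite ltr_pdivlMr ?ltr_wpDl//.
by have := rnorm_ge0 (expA b - expA a); lra.
Qed.

Lemma speed_continuous gamma : smooth_curve gamma ->
  {within `[0, 1], continuous (fun t => norm_at tau (gamma t) (velocity gamma t))}.
Proof.
move=> [Sg dg vg]; apply/subspace_continuousP => t t01.
have t01' : 0 <= t <= 1 by move: t01; rewrite /= in_itv.
have sag s : 0 <= s <= 1 -> selfadj (gamma s).
  move=> s01; have [|b hb <-] := Sg s; first by rewrite in_itv.
  exact: selfadj_expA.
have eqn s : s \in `[0, 1] -> norm_at tau (gamma s) (velocity gamma s) =
    tnorm (expA (- (2^-1 *r logA (gamma s))) * velocity gamma s *
        expA (- (2^-1 *r logA (gamma s)))).
  move=> s01; have s01' : 0 <= s <= 1 by move: s01; rewrite /= in_itv.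
  have hv : selfadj (velocity gamma s) by apply: velocity_selfadj => //; exact: dg.
  by have [b hb <-] := Sg s s01; rewrite logA_expA// norm_atE.
set f := fun s => norm_at _ _ _.
pose h s := tnorm (expA (- (2^-1 *r logA (gamma s))) * velocity gamma s *
  expA (- (2^-1 *r logA (gamma s)))).
have fh s : s \in `[0, 1] -> f s = h s by exact: eqn.
suff : h @ within `[0, 1] (nbhs t) --> h t.
  rewrite -(fh t t01); apply: cvg_trans; apply: near_eq_cvg.
  by rewrite near_withinE; apply: nearW => s s01; apply/esym/fh.
apply: cvg_tnorm; have cl : (fun s => logA (gamma s)) @ within `[0, 1] (nbhs t)
    --> logA (gamma t).
  apply: cvg_logA; [exact: Sg| |exact: (curve_cvg t01' (dg t t01))].
  by rewrite near_withinE; apply: nearW => s; exact: Sg.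
have cq : (fun s => expA (- (2^-1 *r logA (gamma s)))) @ within `[0, 1] (nbhs t)
    --> expA (- (2^-1 *r logA (gamma t))).
  by apply: cvg_expA; apply: cvgN; apply: cvgZ => //; exact: cvg_cst.
apply: cvgM_op; last exact: cq.
apply: cvgM_op; first exact: cq.
exact: ((subspace_continuousP _ _).1 vg t t01).
Qed.

Lemma gdist_lipschitz x y z : Sigma x -> Sigma y -> Sigma z ->
  `|gdist x y - gdist x z| <= gdist y z.
Proof.
move=> [c hc <-] Sy Sz; have ginv := inverses_expA (2^-1 *r c).
have sg : star (expA (2^-1 *r c)) = expA (2^-1 *r c).
  exact: (selfadj_expA (selfadjZ _ hc)).
have [a ha ->] := coord_at ginv Sy; have [b hb ->] := coord_at ginv Sz.
have -> : expA c = expA (2^-1 *r c) * star (expA (2^-1 *r c)) by rewrite sg -expA_half.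
rewrite !(gdist_coord tauP ginv)//; apply: le_trans (tnorm_dist tauP a b) _.
exact: (gdist_coord_ge tauP ginv).
Qed.

Lemma gdistxx x : Sigma x -> gdist x x = 0.
Proof.
move=> [c hc <-]; have ginv := inverses_expA (2^-1 *r c).
have sg : star (expA (2^-1 *r c)) = expA (2^-1 *r c).
  exact: (selfadj_expA (selfadjZ _ hc)).
have := gdist_coord tauP ginv (selfadjZ 0 hc); rewrite scale0r expA0 mulr1 sg -expA_half => ->.
by rewrite -(scale0r (0 : A)) -[0 in LHS]/(0%:C) tnormZ// normr0 mul0r.
Qed.

(** Near [1] the logarithm [k] is close to [e^k - 1], relative to its trace norm. *)
Lemma tnorm_log_le (e : R) : 0 < e -> exists2 d, 0 < d &
  forall k, selfadj k -> rnorm (expA k - 1) < d -> tnorm k <= (1 + e) * tnorm (expA k - 1).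
Proof.
move=> e0; have s0 : selfadj (0 : A).
  by rewrite /selfadj /= -(scale0r 0) starZ rmorph0 !scale0r.
have [K [d [K0 d0 lip]]] := log_lipschitz_at s0.
rewrite expA0 in lip; set n : R := e / (1 + e).
have e1 : 0 < 1 + e by rewrite addr_gt0.
have n0 : 0 < n by rewrite divr_gt0.
have E0 : 0 < expR 1 :> R by exact: expR_gt0.
pose m := Num.min 1 (n / expR 1); have m0 : 0 < m by rewrite lt_min ltr01 divr_gt0.
exists (Num.min d (m / (K + 1))); first by rewrite lt_min d0 divr_gt0// ltr_wpDl.
move=> k hk; rewrite lt_min => /andP[kd km].
have kN : rnorm k <= m.
  have := lip k hk kd; rewrite subr0 => h; apply: le_trans h _.
  move: km; rewrite ltr_pdivlMr ?ltr_wpDl//.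
  by have := rnorm_ge0 (expA k - 1); lra.
have [w ew wb] := expA_expand k.
have k1 : rnorm k <= 1 by apply: le_trans kN _; rewrite /m ge_min lexx.
have wn : rnorm w <= n.
  apply: le_trans wb _; rewrite -ler_pdivlMr ?expR_gt0//.
  apply: (@le_trans _ _ (n / expR 1)).
    by apply: le_trans kN _; rewrite /m ge_min lexx orbT.
  by rewrite ler_pM2l// lef_pV2 ?posrE ?expR_gt0// ler_expR.
have ek : k = expA k - 1 - k * w.
  by rewrite ew addrAC addrK [1 + k]addrC addrK.
have h : tnorm k <= tnorm (expA k - 1) + tnorm k * n.
  rewrite {1}ek; apply: le_trans (tnormD tauP _ _) _; rewrite tnormN// lerD2l.
  by apply: le_trans (tnorm_mulr tauP _ _) _; rewrite ler_wpM2l ?tnorm_ge0.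
have en : (1 + e) * (1 - n) = 1 by rewrite /n; field; rewrite gt_eqF.
have h' : tnorm k * (1 - n) <= tnorm (expA k - 1) by lra.
by have := ler_wpM2l (ltW e1) h'; rewrite mulrCA en mulr1.
Qed.

(** The speed of a curve bounds the rate at which the geodesic distance to its
    origin changes. *)
Lemma gdist_le_Length gamma : smooth_curve gamma ->
  gdist (gamma 0) (gamma 1) <= Length tau gamma.
Proof.
move=> sm; have [Sg dg vg] := sm.
have Sg' s : 0 <= s <= 1 -> Sigma (gamma s) by move=> s01; apply: Sg; rewrite in_itv.
have S0 : Sigma (gamma 0) by apply: Sg'; rewrite lexx ler01.
have z0 : gdist (gamma 0) (gamma 0) = 0 by exact: gdistxx.
have := @increment_le_integral _ (fun t => gdist (gamma 0) (gamma t)) _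
  (speed_continuous sm).
rewrite z0 subr0; apply.
move=> t e t01 e0; have [c hc ec] := Sg' t t01.
set v := velocity gamma t; have cv : cvg (diff_quotient gamma t) by apply: dg; rewrite in_itv.
have hv : selfadj v.
  apply: velocity_selfadj => // s s01; have [b hb <-] := Sg' s s01.
  exact: selfadj_expA.
set q := expA (- (2^-1 *r c)); set g := expA (2^-1 *r c).
have sg : star g = g by exact: (selfadj_expA (selfadjZ _ hc)).
have ginv : inverses g q by exact: inverses_expA.
have [gq qg] := ginv.
set sigma := tnorm (q * v * q).
have -> : norm_at tau (gamma t) v = sigma by rewrite -ec norm_atE.
have sig0 : 0 <= sigma by exact: tnorm_ge0.
pose B := rnorm q * rnorm q; have B0 : 0 <= B by rewrite mulr_ge0 ?rnorm_ge0.
pose dl := Num.min 1 (e / 2); have dl0 : 0 < dl by rewrite lt_min ltr01 divr_gt0.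
have dl1 : dl <= 1 by rewrite /dl ge_min lexx.
have dl2 : dl <= e / 2 by rewrite /dl ge_min lexx orbT.
pose e1 := e / (2 * (sigma + 1)).
have s1 : 0 < sigma + 1 by rewrite ltr_wpDl.
have e10 : 0 < e1 by rewrite divr_gt0// mulr_gt0.
have ee : e1 * (sigma + 1) = e / 2 by rewrite /e1; field; rewrite gt_eqF.
have [d1 d10 hlog] := tnorm_log_le e10.
have dB : 0 < dl / (B + 1) by rewrite divr_gt0// ltr_wpDl.
have [d2 d20 hexp] := velocity_expansion t01 dB cv.
pose C := rnorm (q * v * q) + dl; have C0 : 0 < C by rewrite ltr_wpDl ?rnorm_ge0.
exists (Num.min d2 (d1 / C)) => [|s s01]; first by rewrite lt_min d20 divr_gt0.
rewrite lt_min => /andP[st2 st1].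
have [z ez zN] := hexp s s01 st2; rewrite -/v -ec in ez.
have Ss := Sg' s s01.
apply: le_trans (gdist_lipschitz S0 Ss (Sg' t t01)) _; rewrite (gdistC tauP Ss (Sg' t t01)).
have [k hk es] := coord_at ginv Ss; rewrite sg in es.
have -> : gdist (gamma t) (gamma s) = tnorm k.
  rewrite -ec es -{2}sg expA_half -/g -{2}sg; exact: (gdist_coord tauP ginv hk).
have qzN : rnorm (q * z * q) <= dl.
  apply: le_trans (rnormM3 _ _ _) _; rewrite mulrAC -/B.
  have : B * rnorm z <= B * (dl / (B + 1)) by rewrite ler_wpM2l// ltW.
  move/le_trans; apply; rewrite mulrA ler_pdivrMr ?ltr_wpDl// mulrC.
  by rewrite ler_wpM2l ?lerDl// ltW.
have ek : expA k - 1 = (s - t) *r (q * v * q + q * z * q).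
  have -> : expA k = q * gamma s * q by rewrite es !mulrA qg mul1r -mulrA gq mulr1.
  rewrite ez mulrDr mulrDl expA_half -/g !mulrA qg mul1r gq addrC addKr.
  by rewrite op_scaleAr op_scaleAl mulrDr mulrDl.
have n2e : tnorm (expA k - 1) <= `|s - t| * (sigma + dl).
  rewrite ek tnormZ// ler_wpM2l//; apply: le_trans (tnormD tauP _ _) _; rewrite lerD2l.
  by apply: le_trans (tnorm_rnorm tauP _) _.
have small : rnorm (expA k - 1) < d1.
  rewrite ek rnormZ; apply: le_lt_trans (_ : `|s - t| * C < _).
    by rewrite ler_wpM2l//; apply: le_trans (rnormD _ _) _; rewrite lerD2l.
  by rewrite -ltr_pdivlMr.
apply: le_trans (hlog k hk small) _.
apply: (@le_trans _ _ ((1 + e1) * (`|s - t| * (sigma + dl)))).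
  by rewrite ler_wpM2l// addr_ge0// ltW.
rewrite mulrCA mulrC ler_wpM2r//.
have : e1 * dl <= e1 * 1 by rewrite ler_wpM2l// ltW.
lra.
Qed.

(** The geodesic has constant speed in the coordinates at its origin, so its
    length is [gdist]. *)
Lemma geodesic_curve x y : Sigma x -> Sigma y -> exists gamma,
  [/\ smooth_curve gamma, gamma 0 = x, gamma 1 = y & Length tau gamma = gdist x y].
Proof.
move=> [a ha <-] Sy; set g := expA (2^-1 *r a); set q := expA (- (2^-1 *r a)).
have sg : star g = g by exact: (selfadj_expA (selfadjZ _ ha)).
have ginv : inverses g q by exact: inverses_expA.
have [gq qg] := ginv.
have [k hk ey] := coord_at ginv Sy; rewrite sg in ey.
pose gamma t := g * expA (t *r k) * g.
pose v t := g * (k * expA (t *r k)) * g.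
have Sg t : Sigma (gamma t).
  by rewrite /gamma -{2}sg; apply: (Sigma_coord ginv); exact: selfadjZ.
have dgamma t : 0 <= t <= 1 -> diff_quotient gamma t --> v t.
  move=> t01; rewrite diff_quotientE; have pf := slopes_proper t01.
  pose C := rnorm g * (rnorm k * (rnorm k * expR (rnorm k)) * rnorm (expA (t *r k))) * rnorm g.
  have C0 : 0 <= C by rewrite !mulr_ge0 ?rnorm_ge0 ?expR_ge0.
  apply/cvg_rnormP => e e0; apply/near_slopesP.
  exists (Num.min 1 (e / (C + 1))) => [|h h0].
    by rewrite lt_min ltr01 divr_gt0// ltr_wpDl.
  rewrite lt_min => /andP[h1 he] _.
  have [w ew wb] := expA_expand (h *r k).
  have es : expA ((t + h) *r k) = expA (h *r k) * expA (t *r k).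
    by rewrite (@expA_scale_eq _ _ _ _ _ (t + h)) // addrC.
  have -> : v t - h^-1 *r (gamma (t + h) - gamma t) = - (g * (k * w * expA (t *r k)) * g).
    have -> : gamma (t + h) - gamma t = h *r (v t + g * (k * w * expA (t *r k)) * g).
      have eE : expA (h *r k) - 1 = h *r (k + k * w).
        by rewrite ew addrAC [1 + _]addrC addrK scalerDr op_scaleAl.
      rewrite /gamma es -mulrBl -mulrBr -[X in _ - X]mul1r -mulrBl eE /v.
      rewrite -mulrDl -mulrDr -mulrDl.
      by rewrite op_scaleAl op_scaleAr op_scaleAl.
    by rewrite rscaleA mulVf// scale1r opprD addrA subrr add0r.
  rewrite rnormN; apply: le_lt_trans (_ : `|h| * C < _).
    have hk1 : rnorm (h *r k) <= rnorm k by apply: rnormZ_le => //; exact: ltW.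
    have wN : rnorm w <= `|h| * (rnorm k * expR (rnorm k)).
      apply: le_trans wb _; rewrite rnormZ -mulrA ler_wpM2l//.
      by rewrite ler_wpM2l ?rnorm_ge0// ler_expR -rnormZ.
    have -> : `|h| * C = rnorm g * (rnorm k * (`|h| * (rnorm k * expR (rnorm k))) *
        rnorm (expA (t *r k))) * rnorm g by rewrite /C; ring.
    apply: le_trans (rnormM3 _ _ _) _.
    rewrite ler_wpM2r ?rnorm_ge0// ler_wpM2l ?rnorm_ge0//.
    apply: le_trans (rnormM3 _ _ _) _.
    by rewrite ler_wpM2r ?rnorm_ge0// ler_wpM2l ?rnorm_ge0.
  by move: he; rewrite ltr_pdivlMr ?ltr_wpDl//; have := normr_ge0 h; lra.
have vel t : 0 <= t <= 1 -> velocity gamma t = v t.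
  by move=> t01; apply: velocity_eq => //; exact: dgamma.
exists gamma; split.
- split=> [t _|t|]; first exact: Sg.
    rewrite in_itv/= => t01; apply/cvg_ex; exists (v t); exact: dgamma.
  apply/subspace_continuousP => t t01.
  have t01' : 0 <= t <= 1 by move: t01; rewrite /= in_itv.
  suff : v @ within `[0, 1] (nbhs t) --> v t.
    rewrite -(vel t t01'); apply: cvg_trans; apply: near_eq_cvg; rewrite near_withinE.
    by apply: nearW => s; rewrite /= in_itv/= => s01; apply/esym/vel.
  apply: cvg_within_filter.
  have cE : (fun s => expA (s *r k)) @ t --> expA (t *r k).
    apply: cvg_expA; apply/cvg_rnormP => e e0; apply/nbhs_ballP.
    have m0 : 0 < rnorm k + 1 by rewrite ltr_wpDl ?rnorm_ge0.
    exists (e / (rnorm k + 1)) => /=; first by rewrite divr_gt0.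
    move=> s; rewrite /ball/= ltr_pdivlMr// => h.
    rewrite -rscaleB rnormZ; apply: le_lt_trans h.
    by rewrite ler_wpM2l// lerDl.
  apply: cvgM_op; last exact: cvg_cst.
  apply: cvgM_op; first exact: cvg_cst.
  by apply: cvgM_op => //; exact: cvg_cst.
- by rewrite /gamma scale0r expA0 mulr1 /g -expA_half.
- by rewrite /gamma scale1r -ey.
have speed t : t \in [set` `[0, 1]] -> norm_at tau (gamma t) (velocity gamma t) = tnorm k.
  rewrite inE /= in_itv/= => t01; rewrite vel// /norm_at /inner.
  have i1 : gamma t * (q * expA (- (t *r k)) * q) = 1.
    rewrite /gamma !mulrA -(mulrA _ g q) gq mulr1 -(mulrA g) expA_mulN mulr1 gq//.
  have i2 : (q * expA (- (t *r k)) * q) * gamma t = 1.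
    rewrite /gamma !mulrA -(mulrA _ q g) qg mulr1 -(mulrA q) expA_Nmul mulr1 qg//.
  rewrite (invA_unique i1 i2); set b := q * _ * q.
  have vb : v t * b = g * k * q.
    rewrite /v /b !mulrA -(mulrA _ g q) gq mulr1 -(mulrA (g * k)) expA_mulN mulr1//.
  rewrite /tnorm; congr Num.sqrt.
  rewrite -[X in complex.Re (tau X)]/(v t * b * v t * b) -mulrA vb -/(retr _).
  rewrite /tdot (hk : star k = k).
  by rewrite !mulrA -(mulrA _ q g) qg mulr1 retrC// !mulrA qg mul1r.
have -> : Length tau gamma = \int[@lebesgue_measure R]_(_ in `[0, 1]) tnorm k.
  by apply: eq_Rintegral => t; exact: speed.
rewrite Rintegral_cst//= lebesgue_measure_itv/= lte_fin ltr01/= subr0 mulr1.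
have -> : expA a = g * star g by rewrite sg /g -expA_half.
have -> : y = g * expA k * star g by rewrite sg.
by rewrite (gdist_coord tauP ginv hk).
Qed.

(** The geodesic attains the lower bound [gdist_le_Length]. *)
Lemma dist_gdist x y : Sigma x -> Sigma y -> dist tau x y = gdist x y.
Proof.
move=> Sx Sy; have [gamma [sm g0 g1 gl]] := geodesic_curve Sx Sy.
have lb : lbound [set Length tau gamma | gamma in
    [set gamma | [/\ smooth_curve gamma, gamma 0 = x & gamma 1 = y]]] (gdist x y).
  by move=> _ [c [sc <- <-] <-]; exact: gdist_le_Length.
apply: le_anti; apply/andP; split.
  by rewrite -gl; apply: ge_inf; [exists (gdist x y)|exists gamma].
by apply: lb_le_inf => //; exists (Length tau gamma); exists gamma.
Qed.

End Lengths.

(** * The projection *)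

Section Projection.
Context {R : realType} {V : hilbertType R} {A : vonNeumannType V}.
Variables (tau : {scalar A}) (H : set A).

Lemma PiM_spec (r : A) : (bundle_exp @` normal_bundle tau H) r ->
  exists a v, [/\ H a, PiM tau H r = expA a,
    Defs.normal_space tau H (expA a) v & r = Exp (expA a) v].
Proof.
move=> [[p0 v0] nb er]; rewrite /PiM; case: xgetP => [p -> [v [[/= [a Ha ea] nv] ev]]|/(_ p0)].
  by exists a, v; rewrite ea.
by case; exists v0.
Qed.

End Projection.

Theorem lemma5p2 (R : realType) (V : hilbertType R) (A : vonNeumannType V)
    (tau : {scalar A}) (H : set A) :
  tracial_state tau ->
  closed_real_subspace H ->
  g_convex (exponential_set H) ->
  forall r s : A,
    (bundle_exp @` normal_bundle tau H) r -> (bundle_exp @` normal_bundle tau H) s ->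
    dist tau (PiM tau H r) (PiM tau H s) <= dist tau r s.
Proof.
move=> tauP Hsub Hconv r s /PiM_spec[a [v [Ha -> nv ->]]] /PiM_spec[b [w [Hb -> nw ->]]].
have [sub _ _ _ _] := Hsub.
have Sa : Sigma (expA a) by exists a => //; exact: sub.
have Sb : Sigma (expA b) by exists b => //; exact: sub.
have [Sr h1] := normal_pythagoras tauP Hsub Hconv Ha Hb nv.
have [Ss h2] := normal_pythagoras tauP Hsub Hconv Hb Ha nw.
rewrite !dist_gdist//.
exact: quadrilateral_contract.
Qed.
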